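(* Let $n\geqslant 2$, let $(M,g)$ be an $n$-dimensional Riemannian manifold, $\Sigma\subset M$ a hypersurface, and $f:\Sigma\to\mathbb R^n$ a smooth isometric immersion. Let $p\in\Sigma$ and let $U\subset M$ be a neighborhood of $p$. If there exists a unit vector $v\in T_p\Sigma$ such that $|h(v,v)|_g>|\bar h(v,v)|$, then no isometric Lipschitz extension $u:U\to\mathbb R^n$ of $f$ can exist.
   Context: $\mathbb R^n$ carries the standard Euclidean metric $g_0=\langle\cdot,\cdot\rangle$, and $f$ isometric means that $f^*g_0$ equals the metric induced by $g$ on $\Sigma$. $A\in\Gamma(\mathrm S^2(T^*\Sigma)\otimes N\Sigma)$ is the second fundamental form of $\Sigma$ in $M$, and $h(X,Y)= g(\nu,A(X,Y))$, where $\nu$ is the (unique up to sign) unit normal field of $\Sigma$ in $M$. $\bar A\in\Gamma(\mathrm S^2(T^*\Sigma)\otimes f^*N\bar\Sigma)$ is the second fundamental form of $\bar\Sigma= f(\Sigma)$ in $\mathbb R^n$ (i.e. of the immersion $f$), and $\bar h(X,Y)=\langle\bar A(X,Y),\bar\nu\rangle$, where $\bar\nu\in\Gamma(f^*N\bar\Sigma)$ is a unit normal field (unique up to sign). The quantities $|h(v,v)|_g=|h(v,v)|$ and $|\bar h(v,v)|$ are absolute values of real numbers and do not depend on the choice of signs. An isometric Lipschitz extension of $f$ to $U$ is a Lipschitz map $u:U\to\mathbb R^n$ with $u^*g_0=g$ almost everywhere on $U$ (with respect to the measure induced by $g$) and $u=f$ on $\Sigma\cap U$. *)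

(* Defs.v *)
From HB Require Import structures.
From mathcomp Require Import all_boot all_order all_algebra.
From mathcomp Require Import all_classical all_reals all_analysis.

Set Implicit Arguments.
Unset Strict Implicit.
Unset Printing Implicit Defensive.

Import Order.TTheory GRing.Theory Num.Theory.
Import numFieldNormedType.Exports.

Local Open Scope classical_set_scope.
Local Open Scope ring_scope.

(* Vectors are rows: the matrix 'J F x acts on the right, dF_x(v) = v *m 'J F x.
   The library norm `|v| on 'rV[R]_n is the max-norm, hence [inner], [enorm]. *)

Section calculus.
Context {R : realType}.

Fixpoint class_C (k m : nat) (V : normedModType R) (O : set 'rV[R]_m)
    (F : 'rV[R]_m -> V) : Prop :=
  if k is k'.+1 then
    (forall x, O x -> differentiable F x) /\
    (forall i, class_C k' O (fun x => 'D_(delta_mx 0 i) F x))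
  else forall x, O x -> {for x, continuous F}.

Definition smooth_on (m : nat) (V : normedModType R) (O : set 'rV[R]_m)
    (F : 'rV[R]_m -> V) : Prop := forall k, class_C k O F.

(* D is a differential at x of the restriction of F to A. *)
Definition is_diff_within (m k : nat) (A : set 'rV[R]_m)
    (F : 'rV[R]_m -> 'rV[R]_k) (x : 'rV[R]_m) (D : 'M[R]_(m, k)) : Prop :=
  forall e : R, 0 < e ->
    \forall y \near x, A y ->
      `|F y - F x - (y - x) *m D| <= e * `|y - x|.

(* Integral over R^n of a nonnegative Borel function with respect to Lebesgue
   measure, as an iterated integral (Tonelli). *)
Fixpoint integral_rV (n : nat) : ('rV[R]_n -> \bar R) -> \bar R :=
  match n return ('rV[R]_n -> \bar R) -> \bar R with
  | 0 => fun F => F 0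
  | n'.+1 => fun F =>
      (\int[@lebesgue_measure R]_(t in setT)
        integral_rV (fun y : 'rV[R]_n' =>
          F (row_mx (t%:M : 'rV[R]_1) y : 'rV[R]_(1 + n'))))%E
  end.

End calculus.

(* A metric in coordinates is a field of Gram matrices G : 'rV_n -> 'M_n. *)
Section coordinate_geometry.
Context {R : realType}.

Definition inner (n : nat) (G : 'M[R]_n) (u v : 'rV[R]_n) : R :=
  (u *m G *m v^T) 0 0.

Definition flat (n : nat) : 'rV[R]_n -> 'M[R]_n := fun=> 1%:M.

Definition enorm (n : nat) (u : 'rV[R]_n) : R := Num.sqrt (inner 1%:M u u).

Definition pullback (m n : nat) (G : 'rV[R]_n -> 'M[R]_n)
    (F : 'rV[R]_m -> 'rV[R]_n) : 'rV[R]_m -> 'M[R]_m :=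
  fun w => 'J F w *m G (F w) *m ('J F w)^T.

Definition christoffel (n : nat) (G : 'rV[R]_n -> 'M[R]_n) (x : 'rV[R]_n)
    (k i j : 'I_n) : R :=
  2^-1 * \sum_(l < n) invmx (G x) k l *
    ('D_(delta_mx 0 i) (fun y => G y j l) x
     + 'D_(delta_mx 0 j) (fun y => G y i l) x
     - 'D_(delta_mx 0 l) (fun y => G y i j) x).

(* Levi-Civita derivative along the map F, at w, of the field dF(Y) in the
   direction dF(X), where X and Y are constant fields on the parameter domain. *)
Definition nabla (m n : nat) (G : 'rV[R]_n -> 'M[R]_n)
    (F : 'rV[R]_m -> 'rV[R]_n) (w X Y : 'rV[R]_m) : 'rV[R]_n :=
  'D_X (fun w' => 'D_Y F w') w
  + \row_k \sum_(i < n) \sum_(j < n)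
      christoffel G (F w) k i j * ('D_X F w) 0 i * ('D_Y F w) 0 j.

(* G-orthogonal projection of z onto the complement of the row space of T, for
   T with independent rows; T *m G *m T^T is the Gram matrix of these rows. *)
Definition normal_part (m n : nat) (G : 'M[R]_n) (T : 'M[R]_(m, n))
    (z : 'rV[R]_n) : 'rV[R]_n :=
  z - z *m G *m T^T *m invmx (T *m G *m T^T) *m T.

(* A(dF X, dF Y) = (nabla_{dF X} dF Y)^perp for an immersion F. The right-hand
   side is tensorial, so constant fields X, Y suffice. *)
Definition second_ff (m n : nat) (G : 'rV[R]_n -> 'M[R]_n)
    (F : 'rV[R]_m -> 'rV[R]_n) (w X Y : 'rV[R]_m) : 'rV[R]_n :=
  normal_part (G (F w)) ('J F w) (nabla G F w X Y).

Definition unit_normal (m n : nat) (G : 'rV[R]_n -> 'M[R]_n)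
    (F : 'rV[R]_m -> 'rV[R]_n) (w : 'rV[R]_m) (nu : 'rV[R]_n) : Prop :=
  inner (G (F w)) nu nu = 1 /\
  forall X : 'rV[R]_m, inner (G (F w)) nu (X *m 'J F w) = 0.

Definition scalar_second_ff (m n : nat) (G : 'rV[R]_n -> 'M[R]_n)
    (F : 'rV[R]_m -> 'rV[R]_n) (w : 'rV[R]_m) (nu : 'rV[R]_n)
    (X Y : 'rV[R]_m) : R :=
  inner (G (F w)) nu (second_ff G F w X Y).

End coordinate_geometry.

(* [cmap] is meaningful on [cdom] only, [cinv] on the image of [cdom] only. *)
Record chart (R : realType) (n : nat) (M : topologicalType) := Chart {
  cdom : set M;
  cmap : M -> 'rV[R]_n;
  cinv : 'rV[R]_n -> M;
  cdom_open : open cdom;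
  cimg_open : open (cmap @` cdom);
  cmapK : forall x, cdom x -> cinv (cmap x) = x;
  cmap_continuous : forall x, cdom x -> {for x, continuous cmap};
  cinv_continuous : forall x, (cmap @` cdom) x -> {for x, continuous cinv}
}.

Record manifold (R : realType) (n : nat) := Manifold {
  mcarrier :> topologicalType;
  m_hausdorff : hausdorff_space mcarrier;
  m_second_countable : @second_countable mcarrier;
  atlas : set (chart R n mcarrier);
  atlas_cover : forall x, exists2 c, atlas c & cdom c x;
  atlas_compatible : forall c d, atlas c -> atlas d ->
    smooth_on (cmap c @` (cdom c `&` cdom d)) (cmap d \o cinv c)
}.

Record riem_metric (R : realType) (n : nat) (M : manifold R n) := RiemMetric {
  gram :> chart R n M -> 'rV[R]_n -> 'M[R]_n;
  gram_smooth : forall c, atlas c -> smooth_on (cmap c @` cdom c) (gram c);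
  gram_sym : forall c x, atlas c -> (cmap c @` cdom c) x ->
    (gram c x)^T = gram c x;
  gram_pos : forall c x, atlas c -> (cmap c @` cdom c) x ->
    forall v, v != 0 -> 0 < inner (gram c x) v v;
  gram_transition : forall c d, atlas c -> atlas d ->
    forall x, (cmap c @` (cdom c `&` cdom d)) x ->
      gram c x = pullback (gram d) (cmap d \o cinv c) x
}.

Section riemannian.
Context {R : realType} {n : nat} {M : manifold R n}.

Definition chart_at (x : M) : chart R n M := s2val (cid2 (atlas_cover x)).

(* A C^1 curve on [0, 1], in the sense of having a C^1 extension to an open
   interval containing [0, 1]. *)
Definition C1_curve (gamma : R -> M) : Prop :=
  forall t, 0 <= t <= 1 -> {for t, continuous gamma} /\
    forall c, atlas c -> cdom c (gamma t) ->
      (\forall s \near t, derivable (cmap c \o gamma) s 1) /\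
      {for t, continuous (derive1 (cmap c \o gamma))}.

Definition speed (g : riem_metric M) (gamma : R -> M) (t : R) : R :=
  let c := chart_at (gamma t) in
  let v := derive1 (cmap c \o gamma) t in
  Num.sqrt (inner (g c (cmap c (gamma t))) v v).

Definition curve_length (g : riem_metric M) (gamma : R -> M) : \bar R :=
  (\int[@lebesgue_measure R]_(t in `[0%R, 1%R]) (speed g gamma t)%:E)%E.

(* Curves of class C^1 need not be regular, so piecewise C^1 curves give the
   same infimum. The value is +oo between distinct components of M. *)
Definition riem_dist (g : riem_metric M) (x y : M) : \bar R :=
  ereal_inf [set curve_length g gamma | gamma in
    [set gamma : R -> M | [/\ C1_curve gamma, gamma 0 = x & gamma 1 = y]]].

Definition riem_lipschitz (g : riem_metric M) (U : set M)
    (u : M -> 'rV[R]_n) : Prop :=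
  exists2 L : R, 0 < L & forall x y, U x -> U y ->
    ((enorm (u x - u y))%:E <= L%:E * riem_dist g x y)%E.

(* N is negligible for the measure sqrt(det g) dx induced by g: in every chart,
   N lies in a Borel set of measure zero. This is a chartwise condition because
   M, being second countable, is covered by countably many charts. *)
Definition riem_negligible (g : riem_metric M) (N : set M) : Prop :=
  forall c, atlas c -> exists B : set 'rV[R]_n,
    [/\ <<s @open 'rV[R]_n >> B,
        cmap c @` (N `&` cdom c) `<=` B,
        B `<=` cmap c @` cdom c &
        integral_rV (fun x => (\1_B x * Num.sqrt (\det (g c x)))%:E) = 0%E].

(* u^* g_0 = g at x, for u defined on U. *)
Definition isometric_at (g : riem_metric M) (U : set M) (u : M -> 'rV[R]_n)
    (x : M) : Prop :=
  forall c, atlas c -> cdom c x ->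
    exists2 D : 'M[R]_n,
      is_diff_within (cmap c @` (U `&` cdom c)) (u \o cinv c) (cmap c x) D &
      D *m D^T = g c (cmap c x).

(* W and s form a smooth local parametrization of S: an immersion of the open
   set W into M which is a homeomorphism onto a relatively open part of S. *)
Definition local_param (S : set M) (W : set 'rV[R]_n.-1)
    (s : 'rV[R]_n.-1 -> M) : Prop :=
  [/\ open W,
      (forall w, W w -> {for w, continuous s}),
      (forall w w', W w -> W w' -> s w = s w' -> w = w'),
      (forall V, open V -> V `<=` W ->
        exists2 O : set M, open O & s @` V = S `&` O) &
      forall c, atlas c ->
        smooth_on (W `&` s @^-1` cdom c) (cmap c \o s) /\
        forall w, W w -> cdom c (s w) -> row_free ('J (cmap c \o s) w)].

Definition hypersurface (S : set M) : Prop :=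
  forall q, S q -> exists W s, local_param S W s /\ (s @` W) q.

(* Only the values of f on S matter. *)
Definition isometric_immersion (g : riem_metric M) (S : set M)
    (f : M -> 'rV[R]_n) : Prop :=
  forall W s, local_param S W s ->
    [/\ smooth_on W (f \o s),
        (forall w, W w -> row_free ('J (f \o s) w)) &
        forall c w, atlas c -> W w -> cdom c (s w) ->
          pullback (@flat R n) (f \o s) w = pullback (g c) (cmap c \o s) w].

(* Only the values of u on U matter. *)
Definition isometric_lipschitz_extension (g : riem_metric M) (S : set M)
    (f : M -> 'rV[R]_n) (U : set M) (u : M -> 'rV[R]_n) : Prop :=
  [/\ riem_lipschitz g U u,
      riem_negligible g [set x | U x /\ ~ isometric_at g U u x] &
      forall x, S x -> U x -> u x = f x].

End riemannian.

(* Main.v *)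
Require Import Defs.
From mathcomp Require Import all_boot all_order all_algebra.
From mathcomp Require Import all_classical all_reals all_analysis.
From mathcomp Require Import measurable_realfun.
From mathcomp Require Import ring lra.

Import Order.TTheory GRing.Theory Num.Theory.
Import numFieldNormedType.Exports.

Local Open Scope classical_set_scope.
Local Open Scope ring_scope.

(** An extension [u] cannot lengthen curves, and a hypersurface that bends more
in [M] than its image bends in R^n has shorter shortcuts in [M] than in R^n.

Let [x] be the curve of parameter [w + tau v] on the hypersurface, read in the
chart [c], and [y] its image under [f]; at each time [x] and [y] have the same
speed because [f] is isometric. Let [z] be the covariant acceleration of [x] at
time 0. The curve
  sigma(tau) = x(tau) + (t^2 - tau^2) / 2 z,      -t <= tau <= t,
has the same endpoints as [x], and is to leading order the geodesic between them. If
[x] has unit speed at time 0 and beta = <x'(0), z>, the length of sigma is that of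
[x] minus t^3 / 3 (|z|^2 - beta^2) + o(t^3). The distance from y(-t) to y(t) is the
length of [y] minus t^3 / 3 (|y''(0)|^2 - beta^2) + o(t^3), with the same beta
because the speeds agree. Since [x] and [y] have the same length, if [u] does not
lengthen sigma, then |z| <= |y''(0)| ([coordinate_obstruction]).

On the other hand the tangential parts of [z] and of y''(0) are determined by the
induced metric (Koszul's formula, [inner_nabla]), hence have the same norm, and
their normal parts are h(v, v) nu and hbar(v, v) nubar. So |h(v, v)| >
|hbar(v, v)| forces |z| > |y''(0)| ([acceleration_lt]), a contradiction.

Two points need care. First, [u] is isometric almost everywhere only, and sigma
may lie in the exceptional set. By Fubini's theorem, arbitrarily small translates
of sigma in the chart meet the exceptional set at a null set of times only
([null_translate]); along them the estimate holds for almost every time, which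
suffices because [u] is Lipschitz ([ae_nonincr_le], [curve_comparison]), and by
continuity of [u] it passes to sigma. Second, expanding lengths to third order
would require third derivatives. Pairing with the unit vector e = y'(0) avoids
them: since d<e, u(sigma)> <= (1 + |sigma'|^2) / 2 dtau, the derivative of
<e, u(sigma) - y> is at most half of
  |y' - e|^2 + |sigma'|^2 - |x'|^2,
where each norm is taken at the point of its own curve. Apart from a term odd in
tau this quantity is of second order in (tau, t), and first-order expansions give
its coefficients. Its integral over [-t, t] is
  2 t^3 / 3 (|y''(0)|^2 - |z|^2) + o(t^3),
while <e, u(sigma) - y> vanishes at both ends. *)

(** * Monotonicity from a derivative known almost everywhere *)

(** The null set where nothing is known about the slope is covered by an
open set of measure at most [e']. On this open set the growth of [f] is charged to
the measure already covered, at rate [L]; elsewhere it is charged to a small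
slope [e']. Since the growth on the left of a point is controlled by continuity,
the set of times up to which the resulting bound holds is all of [[a, b]]. *)
Lemma ae_nonincr_le (R : realType) (f : R -> R) (a b L : R) (N : set R) :
  a <= b -> 0 <= L ->
  (forall x, a <= x <= b -> {for x, continuous f}) ->
  (forall x, a <= x < b -> \forall y \near x, x < y -> f y - f x <= L * (y - x)) ->
  (@lebesgue_measure R).-negligible N ->
  (forall x, a <= x < b -> ~ N x -> forall e, 0 < e ->
     \forall y \near x, x < y -> f y - f x <= e * (y - x)) ->
  f b <= f a.
Proof.
move=> ab L0 fc fL [D [mD D0 ND]] fN.
apply/ler_addgt0Pr => e e0.
(* Slope e' over [a, b] and rate L over a set of measure e' cost at most e' (b - a + L). *)
pose e' := e / (b - a + L + 1).
have den0 : 0 < b - a + L + 1 by apply: ltr_wpDl => //; apply: addr_ge0 => //; rewrite subr_ge0.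
have e'0 : 0 < e' by exact: divr_gt0.
have eE : e = e' * (b - a + L + 1) by rewrite /e' divfK// gt_eqF.
have D0' : (@lebesgue_measure R D = 0)%E by [].
have Doo : (@lebesgue_measure R D < +oo)%E by rewrite D0'.
have [Q [opQ DO Oe]] := @lebesgue_regularity_outer R D e' mD Doo e'0.
have mO : measurable Q by exact: open_measurable.
have leM (X Y : set R) : measurable X -> measurable Y -> X `<=` Y ->
    (@lebesgue_measure R X <= @lebesgue_measure R Y)%E.
  by move=> mX mY XY; apply: le_measure => //; rewrite inE.
have muO : (@lebesgue_measure R Q <= e'%:E)%E.
  rewrite (_ : Q = D `|` (Q `\` D)); last by rewrite setDUK.
  apply: (le_trans (measureU2 (@lebesgue_measure R) mD (measurableD mO mD))).
  by rewrite [X in (X + _)%E]D0' add0e ltW.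
pose m s := fine (@lebesgue_measure R (Q `&` `[a, s])).
have mI (s : R) : measurable (Q `&` `[a, s]) by exact: measurableI.
have mfin s : (@lebesgue_measure R (Q `&` `[a, s]) \is a fin_num)%E.
  rewrite ge0_fin_numE//; apply: (@le_lt_trans _ _ e'%:E); last by rewrite ltry.
  by apply: le_trans muO; apply: leM => //; exact: subIsetl.
have mE s : (m s)%:E = @lebesgue_measure R (Q `&` `[a, s]) by rewrite /m fineK.
have m0 s : 0 <= m s by rewrite /m fine_ge0.
have mle s r : s <= r -> m s <= m r.
  move=> sr; rewrite -lee_fin !mE; apply: leM => //.
  apply: setIS => x /=; rewrite !in_itv/= => /andP[-> /le_trans]; exact.
have mS s r : a <= s -> s <= r -> (forall x, s < x <= r -> Q x) -> m s + (r - s) <= m r.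
  move=> as_ sr sO; rewrite -lee_fin EFinD !mE.
  have -> : ((r - s)%:E = @lebesgue_measure R `]s, r])%E.
    rewrite lebesgue_measure_itv/= lte_fin; case: ltP => // rs.
    by rewrite (@le_anti _ _ r s) ?subrr// sr rs.
  have dis : (Q `&` `[a, s]) `&` `]s, r] = set0.
    rewrite -subset0 => x [[_ /=]]; rewrite !in_itv/= => /andP[_ xs] /andP[sx _].
    by move: (lt_le_trans sx xs); rewrite ltxx.
  rewrite -(measureU (@lebesgue_measure R) (mI s) (measurable_itv _) dis).
  apply: leM => //; first exact: measurableU.
  move=> x [[Qx xI]|xI]; move: xI; rewrite /= in_itv/= => /andP[h1 h2]; split => //.
  - by rewrite /= in_itv/= h1 (le_trans h2).
  - by apply: sO; rewrite h1.
  - by rewrite /= in_itv/= h2 (le_trans as_)// ltW.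
pose ok s := f s <= f a + e' * (s - a) + L * m s.
pose A := [set s | a <= s <= b /\ forall r, a <= r <= s -> ok r].
have oka : ok a by rewrite /ok subrr mulr0 addr0 lerDl mulr_ge0.
have Aa : A a.
  split; first by rewrite lexx.
  by move=> r /andP[h1 h2]; rewrite (@le_anti _ _ r a) ?h1 ?h2.
have supA : has_sup A by split; [exists a|exists b => x [/andP[]]].
set c := sup A.
have ac : a <= c by apply: ub_le_sup Aa; case: supA.
have cb : c <= b by apply: ge_sup; [exists a|move=> x [/andP[]]].
have lec r : a <= r < c -> ok r.
  move=> /andP[ar rc]; have [x Ax rx] := sup_gt (ex_intro _ _ Aa) rc.
  by case: Ax => _; apply; rewrite ar ltW.
have okc : ok c.
  have [ca|ca] := leP c a; first by rewrite (@le_anti _ _ c a) ?ca ?ac.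
  apply/ler_addgt0Pr => d d0.
  have := fc c; rewrite ac cb => /(_ isT) /cvgrPdist_lt/(_ d d0)/nbhs_ballP[k /= k0 kP].
  pose r := Num.max a (c - k / 2).
  have k20 : 0 < k / 2 by rewrite divr_gt0.
  have rc : r < c by rewrite gt_max ca/= ltrBlDr ltrDl.
  have ar : a <= r by rewrite le_max lexx.
  have kr : c - k / 2 <= r by rewrite le_max lexx orbT.
  have := lec r; rewrite ar rc => /(_ isT); rewrite /ok => okr.
  have bcr : ball c k r by rewrite /ball/= gtr0_norm ?subr_gt0//; lra.
  have := le_lt_trans (ler_norm _) (kP _ bcr) => /= h1.
  have h2 : L * m r <= L * m c by rewrite ler_wpM2l// mle// ltW.
  have h3 : e' * (r - a) <= e' * (c - a) by rewrite (ler_pM2l e'0) lerD2r ltW.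
  lra.
have Ac : A c.
  split; first by rewrite ac.
  move=> r /andP[ar]; rewrite le_eqVlt => /predU1P[->//|rc].
  by apply: lec; rewrite ar.
have cEb : c = b.
  apply/eqP; rewrite eq_le cb/= leNgt; apply/negP => cltb.
  have : \forall y \near c, c < y -> y <= b -> (forall r, c <= r <= y -> ok r).
    have [Oc|nOc] := pselect (Q c).
      have nL := fL c; rewrite ac cltb in nL.
      have [d /= d0 dOL] := (nbhs_ballP _ _).1 (filterI (open_nbhs_nbhs (conj opQ Oc)) (nL isT)).
      have dO x (bx : ball c d x) : Q x by have [] := dOL x bx.
      exists d => //= y /= cy cly yb r /andP[cr ry].
      have rb := le_trans ry yb.
      have [<-//|clr] : c = r \/ c < r by move: cr; rewrite le_eqVlt => /predU1P[|]; [left|right].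
      have Or x : c < x <= r -> Q x.
        move=> /andP[cx xr]; apply: dO; move: cy.
        rewrite /ball/= !ltr0_norm ?subr_lt0// ?(lt_le_trans _ rb)// => h; lra.
      have := mS c r ac cr Or.
      have bcr : ball c d r by move: cy; rewrite /ball/= !ltr0_norm ?subr_lt0// => h; lra.
      have [_ /(_ clr)] := dOL r bcr.
      move: okc; rewrite /ok => h1 h2 h3.
      have h4 : L * (m c + (r - c)) <= L * m r by rewrite ler_wpM2l.
      have h5 : e' * (c - a) <= e' * (r - a) by rewrite (ler_pM2l e'0) lerD2r.
      lra.
    have nNc : ~ N c by move=> /ND /DO.
    have := fN c _ nNc e' e'0; rewrite ac cltb => /(_ isT) /nbhs_ballP[d /= d0 dN].
    exists d => //= y /= cy cly yb r /andP[cr ry].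
    have : c < r \/ c = r by move: cr; rewrite le_eqVlt => /predU1P[|]; [right|left].
    case=> [clr|<-//].
    have : ball c d r by move: cy; rewrite /ball/= !ltr0_norm ?subr_lt0// => h; lra.
    move=> /dN /(_ clr) h1.
    have h2 : L * m c <= L * m r by rewrite ler_wpM2l// mle.
    by move: okc; rewrite /ok; lra.
  move=> /nbhs_ballP[d /= d0 dc].
  pose y := Num.min b (c + d / 2).
  have cy : c < y by rewrite lt_min cltb/= ltrDl divr_gt0.
  have yb : y <= b by rewrite ge_min lexx.
  have yd : y <= c + d / 2 by rewrite ge_min lexx orbT.
  have bcy : ball c d y.
    by rewrite /ball/= ltr0_norm ?subr_lt0//; lra.
  have Ay : A y.
    split; first by rewrite yb andbT (le_trans ac)// ltW.
    move=> r /andP[ar ry]; have [rc|cr] := ltP r c; first by apply: lec; rewrite ar.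
    by apply: (dc _ bcy cy yb); rewrite cr.
  have : y <= c by apply: ub_le_sup Ay; case: supA.
  by rewrite leNgt cy.
have := okc; rewrite /ok cEb => /le_trans; apply.
rewrite -addrA lerD2l eE.
have mb : m b <= e'.
  by rewrite -lee_fin mE; apply: le_trans muO; apply: leM => //; exact: subIsetl.
have : L * m b <= L * e' by rewrite ler_wpM2l.
by lra.
Qed.

(** * Lebesgue integration on row vectors, coordinate by coordinate *)

Local Notation borel R n := (g_sigma_algebraType (@open 'rV[R]_n)).

Lemma rV_norm_lt (R : realType) (n : nat) (x : 'rV[R]_n) (e : R) : 0 < e ->
  (forall i, `|x 0 i| < e) -> `|x| < e.
Proof.
move=> e0 xe; rewrite [`|x|]mx_normrE; apply/bigmax_ltP; split => // -[i j] _ /=.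
by rewrite ord1.
Qed.

Lemma rV_norm_le (R : realType) (n : nat) (x : 'rV[R]_n) (e : R) : 0 <= e ->
  (forall i, `|x 0 i| <= e) -> `|x| <= e.
Proof.
move=> e0 xe; rewrite [`|x|]mx_normrE; apply/bigmax_leP; split => // -[i j] _ /=.
by rewrite ord1.
Qed.

Lemma rV_coord_le (R : realType) (m n : nat) (x : 'M[R]_(m, n)) i j : `|x i j| <= `|x|.
Proof. by rewrite [leRHS]mx_normrE; apply: (le_bigmax _ _ (i, j)). Qed.

(** The Borel sets of a product of lines are generated by the coordinates:
an open set is the countable union of the rational boxes that it contains. *)
Lemma measurable_coords (R : realType) d (T : measurableType d) (n : nat)
    (f : T -> borel R n) :
  (forall i, measurable_fun setT (fun x => (f x : 'rV[R]_n) 0 i)) ->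
  measurable_fun setT f.
Proof.
move=> mf; apply: (@measurability _ _ _ (borel R n) setT f (@open 'rV[R]_n)) => // _ [Q opQ <-].
rewrite setTI.
pose box (qk : 'rV[rat]_n * nat) : set 'rV[R]_n :=
  [set x | forall i, `|x 0 i - ratr (qk.1 0 i)| < qk.2.+1%:R^-1].
have -> : f @^-1` Q = \bigcup_(qk in [set qk | box qk `<=` Q]) (f @^-1` box qk).
  apply/seteqP; split => [x /= Qx|x [qk /= h]]; last exact: h.
  have [e /= e0 eQ] := (nbhs_ballP _ _).1 (open_nbhs_nbhs (conj opQ Qx)).
  have e20 : 0 < e / 2 by rewrite divr_gt0.
  near \oo => k.
  have ke : k.+1%:R^-1 < e / 2 :> R by near: k; exact: near_infty_natSinv_lt (PosNum e20).
  have k0 : 0 < k.+1%:R^-1 :> R by rewrite invr_gt0.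
  have qi i : exists q : rat, `|(f x : 'rV[R]_n) 0 i - ratr q| < k.+1%:R^-1.
    have /rat_in_itvoo[q] : (f x : 'rV[R]_n) 0 i - k.+1%:R^-1 < (f x : 'rV[R]_n) 0 i + k.+1%:R^-1.
      by rewrite ltrBlDr -addrA ltrDl addr_gt0.
    rewrite in_itv/= => /andP[h1 h2]; by exists q; rewrite ltr_distlC h1 h2.
  have [q qP] := choice qi.
  exists (\row_i q i, k) => /=; last by move=> i /=; rewrite mxE.
  move=> y /= yb; apply: eQ; rewrite -ball_normE/=; apply: rV_norm_lt => // i.
  rewrite !mxE -(subrKA (ratr (q i))) (splitr e).
  apply: le_lt_trans (ler_normD _ _) _; apply: ltrD; first exact: lt_trans (qP i) ke.
  by have := yb i; rewrite /= mxE distrC => /lt_trans; apply.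
rewrite bigcup_mkcond; apply: countable_bigcupT_measurable => [|qk]; first exact: countableP.
case: ifP => // _; case: qk.
move=> q k.
have -> : f @^-1` box (q, k) =
    \bigcap_(i in [set: 'I_n]) ((fun x => (f x : 'rV[R]_n) 0 i) @^-1` (ball (ratr (q 0 i) : R) k.+1%:R^-1)).
  apply/seteqP; split => x /= h i; first by move=> _ /=; rewrite /ball/= distrC; exact: h.
  by have := h i Logic.I; rewrite /ball/= distrC.
apply: fin_bigcap_measurable => // i _.
by rewrite -[X in measurable X]setTI; apply: mf => //; exact: measurable_ball.
Unshelve. all: by end_near. Qed.

Lemma measurable_coord (R : realType) (n : nat) (i : 'I_n) :
  measurable_fun setT (fun x : borel R n => (x : 'rV[R]_n) 0 i).
Proof.
apply: (measurability _ (RGenOpens.measurableE R)) => // _ [_ [a [b ->]] <-].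
rewrite setTI; apply: sub_sigma_algebra.
by apply: open_comp; [move=> x _; exact: coord_continuous|exact: interval_open].
Qed.

Lemma measurable_row_mx (R : realType) (n : nat) d (T : measurableType d)
    (g : T -> R) (h : T -> borel R n) :
  measurable_fun setT g -> measurable_fun setT h ->
  measurable_fun setT (fun z =>
    (row_mx ((g z)%:M : 'rV[R]_1) (h z : 'rV[R]_n) : borel R (1 + n))).
Proof.
move=> mg mh; apply: measurable_coords => i; have [j ->|j ->] := split_ordP i.
  apply: (eq_measurable_fun g) => //= z _.
  by rewrite row_mxEl mxE !ord1 eqxx mulr1n.
apply: (eq_measurable_fun (fun z => (h z : 'rV[R]_n) 0 j)).
  by move=> z _; rewrite row_mxEr.
exact: (measurableT_comp (@measurable_coord R n j) mh).
Qed.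

Section tonelli.
Context {R : realType}.
Local Open Scope ereal_scope.

Lemma integral_rV_ge0 (n : nat) (F : 'rV[R]_n -> \bar R) :
  (forall x, 0 <= F x) -> 0 <= integral_rV F.
Proof.
elim: n F => [|n IHn] F F0 /=; first exact: F0.
by apply: integral_ge0 => t _; apply: IHn.
Qed.

(** At each coordinate the integral is a supremum over the simple functions
below the integrand, hence monotone for arbitrary nonnegative functions. *)
Lemma le_integral_rV (n : nat) (F G : 'rV[R]_n -> \bar R) :
  (forall x, 0 <= F x) -> (forall x, F x <= G x) ->
  integral_rV F <= integral_rV G.
Proof.
elim: n F G => [|n IHn] F G F0 FG /=; first exact: FG.
have G0 x : 0 <= G x := le_trans (F0 x) (FG x).
rewrite !ge0_integralTE; [|by move=> t; exact: integral_rV_ge0..].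
apply: le_ereal_sup => _ [h /= hF <-]; exists h => // t.
by apply: le_trans (hF t) _; apply: IHn.
Qed.

(** The parameter space [T] is arbitrary so that the induction can absorb the
coordinate integrated last into it. *)
Lemma measurable_integral_rV (n : nat) d (T : measurableType d)
    (F : T * borel R n -> \bar R) :
  measurable_fun setT F -> (forall z, 0 <= F z) ->
  measurable_fun setT (fun t => integral_rV (fun a : 'rV[R]_n => F (t, a))).
Proof.
elim: n d T F => [|n IHn] d T F mF F0 /=.
  by apply: (measurableT_comp mF); exact: measurable_fun_pair.
pose H (z : T * R) := integral_rV (fun a : 'rV[R]_n =>
  F (z.1, row_mx (z.2%:M : 'rV[R]_1) a : borel R n.+1)).
have mH : measurable_fun setT H.
  apply: (IHn _ (T * R)%type (fun z : (T * R) * borel R n =>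
    F (z.1.1, row_mx (z.1.2%:M : 'rV[R]_1) (z.2 : 'rV[R]_n) : borel R n.+1))) => //.
  apply: (measurableT_comp mF); apply: measurable_fun_pair.
    exact: (measurableT_comp measurable_fst measurable_fst).
  apply: measurable_row_mx => //.
  exact: (measurableT_comp measurable_snd measurable_fst).
have H0 z : 0 <= H z by exact: integral_rV_ge0.
have := @measurable_fun_fubini_tonelli_F _ _ T _ R (@lebesgue_measure R) H mH H0.
rewrite /fubini_F /H /=. exact.
Qed.

(** One application of the two-dimensional Tonelli theorem for each coordinate. *)
Lemma tonelli_integral_rV (n : nat) (F : R * borel R n -> \bar R) :
  measurable_fun setT F -> (forall z, 0 <= F z) ->
  \int[lebesgue_measure]_t integral_rV (fun a : 'rV[R]_n => F (t, a)) =
  integral_rV (fun a : 'rV[R]_n => \int[lebesgue_measure]_t F (t, a)).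
Proof.
elim: n F => [|n IHn] F mF F0 //=.
pose H (z : R * R) := integral_rV (fun a : 'rV[R]_n =>
  F (z.1, row_mx (z.2%:M : 'rV[R]_1) a : borel R n.+1)).
have mK : measurable_fun setT (fun z : (R * R) * borel R n =>
    F (z.1.1, row_mx (z.1.2%:M : 'rV[R]_1) (z.2 : 'rV[R]_n) : borel R n.+1)).
  apply: (measurableT_comp mF); apply: measurable_fun_pair.
    exact: (measurableT_comp measurable_fst measurable_fst).
  apply: measurable_row_mx => //.
  exact: (measurableT_comp measurable_snd measurable_fst).
have mH : measurable_fun setT H by apply: measurable_integral_rV mK _.
have H0 z : 0 <= H z by exact: integral_rV_ge0.
rewrite (@fubini_tonelli _ _ _ _ R (@lebesgue_measure R) (@lebesgue_measure R) H mH H0).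
apply: eq_integral => r _.
apply: (IHn (fun z => F (z.1, row_mx (r%:M : 'rV[R]_1) (z.2 : 'rV[R]_n) : borel R n.+1))) => //.
apply: (measurableT_comp mF); apply: measurable_fun_pair => //.
exact: measurable_row_mx.
Qed.

End tonelli.

Section translation.
Context {R : realType}.
Local Open Scope ereal_scope.

(** Lebesgue measure is determined by its values on half-open intervals, which
are translation invariant. *)
Lemma ge0_integral_translate (f : R -> \bar R) (c : R) :
  measurable_fun setT f -> (forall t, 0 <= f t) ->
  \int[@lebesgue_measure R]_t f (c + t)%R = \int[@lebesgue_measure R]_t f t.
Proof.
move=> mf f0.
have mc : measurable_fun setT (fun t : R => (c + t)%R) by exact: measurable_funD.
pose phi := fun t : measurableTypeR R => (c + t)%R : measurableTypeR R.
have mphi : measurable_fun setT phi by exact: mc.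
have -> : \int[@lebesgue_measure R]_t f t = \int[pushforward (@lebesgue_measure R) phi]_t f t.
  apply: eq_measure_integral => A mA _.
  apply: lebesgue_measure_unique => // _ [[a b] _ <-].
  transitivity (@lebesgue_measure R `](a - c)%R, (b - c)%R]).
    rewrite !lebesgue_measure_itv/= !lte_fin ltrD2r; case: ifP => // _.
    by rewrite -!EFinD; congr (_%:E); ring.
  transitivity (@lebesgue_measure R (phi @^-1` `]a, b])); last by [].
  congr (lebesgue_measure _).
  by apply/seteqP; split => x /=; rewrite !in_itv/= ltrBlDl lerBrDl.
by rewrite ge0_integral_pushforward//= preimage_setT.
Qed.

Lemma integral_rV_translate (n : nat) (F : borel R n -> \bar R) (c : 'rV[R]_n) :
  measurable_fun setT F -> (forall x, 0 <= F x) ->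
  integral_rV (fun a : 'rV[R]_n => F (c + a)%R) = integral_rV (F : 'rV[R]_n -> _).
Proof.
elim: n F c => [|n IHn] F c mF F0.
  by rewrite /=; congr F; rewrite [LHS]thinmx0.
have mrow t : measurable_fun setT (fun a : borel R n =>
    F (row_mx (t%:M : 'rV[R]_1) (a : 'rV[R]_n) : borel R n.+1)).
  by apply: (measurableT_comp mF); exact: measurable_row_mx.
have mI : measurable_fun setT (fun t : R => integral_rV (fun a : 'rV[R]_n =>
    F (row_mx (t%:M : 'rV[R]_1) a : borel R n.+1))).
  apply: (measurable_integral_rV n _ _ (fun z : R * borel R n =>
    F (row_mx (z.1%:M : 'rV[R]_1) (z.2 : 'rV[R]_n) : borel R n.+1))) => //.
  by apply: (measurableT_comp mF); exact: measurable_row_mx.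
rewrite /= -[RHS](ge0_integral_translate _ ((lsubmx (c : 'rV[R]_(1 + n))) 0%R 0%R)) //; last first.
  by move=> t; exact: integral_rV_ge0.
apply: eq_integral => t _.
rewrite -[RHS](IHn _ (rsubmx (c : 'rV[R]_(1 + n))))//.
congr integral_rV; apply/funext => a; congr F.
transitivity (row_mx (lsubmx (c : 'rV[R]_(1 + n)) + t%:M) (rsubmx (c : 'rV[R]_(1 + n)) + a))%R.
  by rewrite -add_row_mx hsubmxK.
have -> : (lsubmx (c : 'rV[R]_(1 + n)) + t%:M)%R =
    (lsubmx (c : 'rV[R]_(1 + n)) 0 0 + t)%:M%R; last by [].
by apply/matrixP => i j; rewrite !ord1 !mxE eqxx !mulr1n.
Qed.

(** A nonnegative function of zero integral vanishes almost everywhere, in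
particular at points arbitrarily close to the origin. Coordinates are chosen one
after the other, each outside a null set. *)
Lemma integral_rV_eq0_small (n : nat) (F : borel R n -> \bar R) (rho : R) :
  measurable_fun setT F -> (forall x, 0 <= F x) ->
  integral_rV (F : 'rV[R]_n -> _) = 0 -> (0 < rho)%R ->
  exists2 a : 'rV[R]_n, (`|a| < rho)%R & F a = 0.
Proof.
elim: n F => [|n IHn] F mF F0 /= IF rho0.
  by exists 0%R => //; rewrite normr0.
have mrow t : measurable_fun setT (fun a : borel R n =>
    F (row_mx (t%:M : 'rV[R]_1) (a : 'rV[R]_n) : borel R n.+1)).
  by apply: (measurableT_comp mF); exact: measurable_row_mx.
pose H (t : R) := integral_rV (fun a : 'rV[R]_n =>
    F (row_mx (t%:M : 'rV[R]_1) a : borel R n.+1)).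
have mI : measurable_fun setT H.
  apply: (measurable_integral_rV n _ _ (fun z : R * borel R n =>
    F (row_mx (z.1%:M : 'rV[R]_1) (z.2 : 'rV[R]_n) : borel R n.+1))) => //.
  by apply: (measurableT_comp mF); exact: measurable_row_mx.
have H0 t : 0 <= H t by exact: integral_rV_ge0.
have /(ae_eq_integral_abs _ measurableT) : \int[@lebesgue_measure R]_t `|H t| = 0.
  by rewrite -IF; apply: eq_integral => t _; rewrite gee0_abs.
case/(_ mI) => N [mN N0 HN].
have [t [tr tN]] : exists t : R, (`|t| < rho)%R /\ ~ N t.
  apply: contrapT => h.
  have sub : `](- rho)%R, rho[ `<=` N.
    move=> t; rewrite /= in_itv/= -ltr_norml => tr; apply: contrapT => tN.
    by apply: h; exists t.
  pose I : set R := `](- rho)%R, rho[%classic.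
  have : @lebesgue_measure R I <= 0.
    by rewrite -[leRHS]N0; apply: le_measure; rewrite ?inE//; exact: measurable_itv.
  rewrite /I lebesgue_measure_itv/= lte_fin gtrN// -EFinD opprK lee_fin leNgt.
  by rewrite addr_gt0.
have Ht : H t = 0.
  by apply: contrapT => Ht; apply: tN; apply: HN => /= /(_ Logic.I).
have [a ar Fa] := IHn _ (mrow t) (fun=> F0 _) Ht rho0.
exists (row_mx (t%:M : 'rV[R]_1) a) => //; apply: rV_norm_lt => // i.
have [j ->|j ->] := split_ordP (i : 'I_(1 + n)).
  have E : (row_mx (t%:M : 'rV[R]_1) a) 0%R (lshift n j) = t.
    by rewrite row_mxEl mxE !ord1 eqxx mulr1n.
  exact: (@eq_ind_r _ _ (fun u => (`|u| < rho)%R) tr _ E).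
have E : (row_mx (t%:M : 'rV[R]_1) a) 0%R (rshift 1 j) = a 0%R j by rewrite row_mxEr.
have aj : (`|a 0%R j| < rho)%R by exact: le_lt_trans (rV_coord_le _ _ _ _ _ _) ar.
exact: (@eq_ind_r _ _ (fun u => (`|u| < rho)%R) aj _ E).
Qed.

(** For each time [t], the translations [a] that carry [sigma t] into [B] form a
null set; by Tonelli, for almost every [a] the times at which the translate by [a]
is in [B] form a null set. The factor [k] lets [B] enter with the weight that the
Riemannian density leaves it locally. *)
Lemma null_translate (n : nat) (B : set (borel R n)) (k : R) (sigma : R -> 'rV[R]_n) (rho : R) :
  measurable B -> (0 < k)%R ->
  integral_rV (fun x : 'rV[R]_n => (\1_B (x : borel R n) * k)%:E) = 0 ->
  continuous sigma -> (0 < rho)%R ->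
  exists2 a : 'rV[R]_n, (`|a| < rho)%R &
    (@lebesgue_measure R).-negligible [set t | B (sigma t + a)%R].
Proof.
move=> mB k0 IB csigma rho0.
pose F (z : R * borel R n) : \bar R := (\1_B ((sigma z.1 + z.2)%R : borel R n) * k)%:E.
have mind : measurable_fun setT (fun x : borel R n => (\1_B x * k)%:E).
  by apply/measurable_EFinP; apply: measurable_funM => //.
have madd : measurable_fun setT (fun z : R * borel R n => (sigma z.1 + z.2)%R : borel R n).
  apply: measurable_coords => i.
  apply: (eq_measurable_fun (fun z : R * borel R n => sigma z.1 0%R i + (z.2 : 'rV[R]_n) 0%R i)%R).
    by move=> z _; rewrite mxE.
  apply: measurable_funD.
    have mi : measurable_fun setT (fun t : R => sigma t 0%R i).
      apply: continuous_measurable_fun => t.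
      apply: (@continuous_comp _ _ _ sigma (fun M : 'rV[R]_n => M 0%R i) t).
        exact: csigma.
      exact: coord_continuous.
    exact: (measurableT_comp mi measurable_fst).
  exact: (measurableT_comp (@measurable_coord R n i) measurable_snd).
have mF : measurable_fun setT F by exact: (measurableT_comp mind madd).
have F0 z : 0 <= F z by rewrite lee_fin mulr_ge0// ltW.
have := tonelli_integral_rV n F mF F0.
rewrite integral0_eq; last first.
  move=> t _; rewrite -[RHS]IB -[RHS](integral_rV_translate n (fun x : borel R n => (\1_B x * k)%:E) (sigma t))//.
  by move=> x; rewrite lee_fin mulr_ge0// ltW.
move=> /esym IF.
have mG : measurable_fun setT (fun a : borel R n => \int[@lebesgue_measure R]_t F (t, a)).
  exact: (@measurable_fun_fubini_tonelli_G _ _ _ _ R (@lebesgue_measure R) F mF F0).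
have [|a ar Ia] := integral_rV_eq0_small _ _ _ mG _ IF rho0.
  by move=> a; apply: integral_ge0.
exists a => //.
have mFa : measurable_fun setT (fun t : R => F (t, a)).
  by apply: (measurableT_comp mF); exact: measurable_fun_pair.
have /(ae_eq_integral_abs _ measurableT) : \int[@lebesgue_measure R]_t `|F (t, a)| = 0.
  by rewrite -Ia; apply: eq_integral => t _; rewrite gee0_abs.
case/(_ mFa) => N [mN N0 HN]; exists N; split => // t /= Bt; apply: HN => /= /(_ Logic.I).
rewrite /F/= indicE mem_set// mul1r => -[] k00.
by move: k0; rewrite k00 ltxx.
Qed.

End translation.

(** * Differential calculus *)

Section differential.
Context {R : realType} {V W : normedModType R}.

Lemma diff_eps (f : V -> W) x e : differentiable f x -> 0 < e ->
  \forall y \near x, `|f y - f x - 'D_(y - x) f x| <= e * `|y - x|.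
Proof.
move=> df e0; have [_ fE] := (diff_locallyP _ _).1 df.
have /eqaddoP /(_ e e0) h : f \o shift x = cst (f x) + 'd f x +o_ 0 id by [].
move: h => /nbhs_ballP[d /= d0 dP].
apply/nbhs_ballP; exists d => //= y; rewrite -ball_normE/= => yd.
have := dP (y - x); rewrite -ball_normE/= sub0r normrN distrC => /(_ yd).
rewrite !fctE/= subrK -addrA -opprD.
by rewrite deriveE.
Qed.

Lemma near_eq_differentiable (f g : V -> W) x :
  {near x, f =1 g} -> differentiable f x -> differentiable g x.
Proof.
move=> fg df; have gx : g x = f x by rewrite (nbhs_singleton fg).
have gE : g \o shift x = cst (g x) + 'd f x +o_ 0 id.
  apply/eqaddoP => e e0; have /= := diff_eps f x e df e0.
  rewrite gx => /(filterI fg) /nbhs_ballP[d /= d0 dP].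
  apply/nbhs_ballP; exists d => //= y; rewrite -ball_normE/= sub0r normrN => yd.
  have [|fy] := dP (y + x).
    by rewrite -ball_normE/= opprD addrCA subrr addr0 normrN.
  by rewrite !fctE/= addrK -fy opprD addrA deriveE.
have cf : continuous ('d f x) by move=> y; exact: (diff_continuous df).
have dgE : 'd g x = 'd f x :> (V -> W) by exact: diff_unique gE.
by apply/diff_locallyP; rewrite dgE.
Qed.

Lemma deriveD_dir (f : V -> W) x a b : differentiable f x ->
  'D_(a + b) f x = 'D_a f x + 'D_b f x.
Proof. by move=> df; rewrite !deriveE// linearD. Qed.

Lemma deriveZ_dir (f : V -> W) x k a : differentiable f x ->
  'D_(k *: a) f x = k *: 'D_a f x.
Proof. by move=> df; rewrite !deriveE// linearZ. Qed.

Lemma derive_sum_dir (I : finType) (f : V -> W) x (a : I -> V) : differentiable f x ->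
  'D_(\sum_i a i) f x = \sum_i 'D_(a i) f x.
Proof.
by move=> df; rewrite deriveE// linear_sum; apply: eq_bigr => i _; rewrite deriveE.
Qed.

Lemma is_derive_line (f : V -> W) (x v : V) (t : R) :
  derivable f (x + t *: v) v ->
  is_derive t (1 : R) (fun t : R => f (x + t *: v)) ('D_v f (x + t *: v)).
Proof.
have E : (fun h : R => h^-1 *: (f (x + (h *: (1 : R) + t) *: v) - f (x + t *: v))) =
    (fun h : R => h^-1 *: (f (h *: v + (x + t *: v)) - f (x + t *: v))).
  apply/funext => h; congr (_ *: (f _ - _)).
  by rewrite scalerDl addrCA /GRing.scale /= mulr1.
move=> df; apply: DeriveDef; first by rewrite /derivable E.
by rewrite /derive E.
Qed.

End differential.

Lemma is_derive_comp_diff (R : realType) (U V W : normedModType R) (f : U -> V) (g : V -> W) x v df :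
  is_derive x v f df -> differentiable f x -> differentiable g (f x) ->
  is_derive x v (g \o f) ('D_df g (f x)).
Proof.
move=> [_ <-] dfx dg.
have dgf : differentiable (g \o f) x by exact: differentiable_comp.
apply: DeriveDef; first exact: diff_derivable.
by rewrite !deriveE// diff_comp.
Qed.

Section matrix_derive.
Context {R : realType} {V : normedModType R}.

Lemma is_derive_mxP m n (M : V -> 'M[R]_(m, n)) x v dM :
  is_derive x v M dM <-> forall i j, is_derive x v (fun y => M y i j) (dM i j).
Proof.
split=> [[Md ME] i j|h].
  apply: DeriveDef; first by have /derivable_mxP := Md.
  by rewrite -ME derive_mx// mxE.
have Md : derivable M x v by apply/derivable_mxP => i j; have [] := h i j.
apply: DeriveDef => //; rewrite derive_mx//; apply/matrixP => i j.
by rewrite mxE; have [_ ->] := h i j.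
Qed.

Lemma is_derive_mulmx m n p (A : V -> 'M[R]_(m, n)) (B : V -> 'M[R]_(n, p)) x v dA dB :
  is_derive x v A dA -> is_derive x v B dB ->
  is_derive x v (fun y => A y *m B y) (dA *m B x + A x *m dB).
Proof.
move=> /is_derive_mxP hA /is_derive_mxP hB; apply/is_derive_mxP => i j.
have -> : (fun y => (A y *m B y) i j) = \sum_(k < n) (fun y => A y i k * B y k j).
  by apply/funext => y; rewrite mxE fct_sumE.
rewrite !mxE -big_split /=; apply: is_derive_sum => k.
have h1 := hA i k; have h2 := hB k j.
have := is_deriveM h1 h2.
move/is_derive_eq; apply.
by rewrite addrC; congr (_ + _); exact: mulrC.
Qed.

Lemma is_derive_trmx m n (A : V -> 'M[R]_(m, n)) x v dA :
  is_derive x v A dA -> is_derive x v (fun y => (A y)^T) dA^T.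
Proof.
move=> /is_derive_mxP hA; apply/is_derive_mxP => i j.
by rewrite mxE (_ : (fun y => _) = (fun y => A y j i))//; apply/funext => y; rewrite mxE.
Qed.

Lemma is_derive_inner n (G : V -> 'M[R]_n) (X Y : V -> 'rV[R]_n) x v dG dX dY :
  is_derive x v G dG -> is_derive x v X dX -> is_derive x v Y dY ->
  is_derive x v (fun y => inner (G y) (X y) (Y y))
    (inner dG (X x) (Y x) + inner (G x) dX (Y x) + inner (G x) (X x) dY).
Proof.
move=> hG hX hY.
have /is_derive_mxP/(_ 0 0) := is_derive_mulmx _ _ _ _ _ _ _ _ _
  (is_derive_mulmx _ _ _ _ _ _ _ _ _ hX hG) (is_derive_trmx _ _ _ _ _ _ hY).
rewrite /inner; move/is_derive_eq; apply.
by rewrite mulmxDl mxE [X in X + _ = _]mxE [X in X + _ = _]addrC.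
Qed.

End matrix_derive.

Section smoothness.
Context {R : realType}.

Lemma smooth_on_differentiable m (V : normedModType R) (Q : set 'rV[R]_m)
    (F : 'rV[R]_m -> V) x : smooth_on Q F -> Q x -> differentiable F x.
Proof. by move=> /(_ 1%N)[+ _] Qx; apply. Qed.

Lemma smooth_on_partial m (V : normedModType R) (Q : set 'rV[R]_m)
    (F : 'rV[R]_m -> V) i : smooth_on Q F -> smooth_on Q (fun x => 'D_(delta_mx 0 i) F x).
Proof. by move=> sF k; have [_] := sF k.+1; apply. Qed.

Lemma derive_partial m (V : normedModType R) (F : 'rV[R]_m -> V) v x :
  differentiable F x -> 'D_v F x = \sum_i v 0 i *: 'D_(delta_mx 0 i) F x.
Proof.
move=> dF; rewrite [in LHS](row_sum_delta v) derive_sum_dir//.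
by apply: eq_bigr => i _; rewrite deriveZ_dir.
Qed.

Lemma smooth_on_derive m (V : normedModType R) (Q : set 'rV[R]_m)
    (F : 'rV[R]_m -> V) v x : open Q -> smooth_on Q F -> Q x ->
  differentiable (fun y => 'D_v F y) x.
Proof.
move=> opQ sF Qx.
apply: (near_eq_differentiable (\sum_i (fun y => v 0 i *: 'D_(delta_mx 0 i) F y))).
  have : nbhs x Q by exact: open_nbhs_nbhs.
  apply: filterS => y Qy; rewrite fct_sumE derive_partial//.
  exact: smooth_on_differentiable sF Qy.
apply: differentiable_sum => i; apply: differentiableZ.
exact: (smooth_on_differentiable _ _ _ _ _ (smooth_on_partial _ _ _ _ i sF) Qx).
Qed.

(** One use of the mean value theorem reduces the second difference to an
increment of ['D_v f], which is then expanded at [x]. *)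
Lemma second_difference (V : normedModType R) (f : V -> R) (x v w : V) e :
  (\forall y \near x, differentiable f y) -> differentiable (fun y => 'D_v f y) x ->
  0 < e -> exists2 d, 0 < d & forall h : R, 0 < h < d ->
    `|f (x + h *: v + h *: w) - f (x + h *: v) - f (x + h *: w) + f x
      - h ^+ 2 * 'D_w (fun y => 'D_v f y) x| <= e * h ^+ 2.
Proof.
move=> /nbhs_ballP[d1 /= d10 df] dDf e0.
set N := `|v| + `|w| + 1.
have N0 : 0 < N by rewrite ltr_wpDl.
pose e' := e / (2 * N).
have e'0 : 0 < e' by rewrite divr_gt0// mulr_gt0.
have /nbhs_ballP[d2 /= d20 dD] := diff_eps _ _ _ dDf e'0.
pose d := Num.min d1 d2 / N.
have d0 : 0 < d by rewrite divr_gt0// lt_min d10.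
exists d => // h /andP[h0 hd].
have hN : h * N < Num.min d1 d2 by rewrite -ltr_pdivlMr.
have nk a b : 0 <= a <= h -> 0 <= b <= h -> `|a *: v + b *: w| <= h * N.
  move=> /andP[a0 ah] /andP[b0 bh]; apply: (le_trans (ler_normD _ _)).
  rewrite !normrZ !ger0_norm// /N !mulrDr mulr1 -addrA lerD//.
    by rewrite ler_wpM2r.
  by apply: ler_wpDr; [exact: ltW|rewrite ler_wpM2r].
have inb a b : 0 <= a <= h -> 0 <= b <= h ->
    ball x d1 (x + (a *: v + b *: w)) /\ ball x d2 (x + (a *: v + b *: w)).
  move=> ha hb; have := le_lt_trans (nk a b ha hb) hN.
  rewrite -!ball_normE /= opprD addNKr normrN lt_min => /andP[]; by split.
pose phi s := f (x + (s *: v + h *: w)) - f (x + (s *: v + 0 *: w)).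
pose dphi s := 'D_v f (x + (s *: v + h *: w)) - 'D_v f (x + (s *: v + 0 *: w)).
have h00 : 0 <= (0 : R) <= h by rewrite lexx ltW.
have hhh : 0 <= h <= h by rewrite lexx ltW.
have dline b s : 0 <= b <= h -> 0 <= s <= h ->
    is_derive s (1 : R) (fun s => f (x + (s *: v + b *: w))) ('D_v f (x + (s *: v + b *: w))).
  move=> hb hs.
  have E t : x + (t *: v + b *: w) = (x + b *: w) + t *: v by rewrite addrAC addrA.
  rewrite (_ : (fun s => _) = (fun s => f ((x + b *: w) + s *: v))); last first.
    by apply/funext => t; rewrite E.
  rewrite E; apply: is_derive_line; apply: diff_derivable; apply: df.
  by rewrite -E; have [] := inb s b hs hb.
have dphiP s : 0 <= s <= h -> is_derive s (1 : R) phi (dphi s).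
  by move=> hs; apply: is_deriveB; apply: dline.
have [||c] := @MVT R phi dphi 0 h h0.
- by move=> s; rewrite in_itv/= => /andP[s0 sh]; apply: dphiP; rewrite !ltW.
- apply: derivable_within_continuous => s; rewrite in_itv/= => hs.
  by have [] := dphiP s hs.
rewrite in_itv/= => /andP[c0 ch].
have hc : 0 <= c <= h by rewrite !ltW.
rewrite /phi subr0 !scale0r !addr0 add0r => Mv.
rewrite (_ : _ - _ - _ + f x = f (x + (h *: v + h *: w)) - f (x + h *: v) - (f (x + h *: w) - f x)); last first.
  by rewrite !addrA; ring.
rewrite Mv /dphi !scale0r !addr0.
have [_ b1] := inb c h hc hhh; have [_ b2] := inb c 0 hc h00.
have := dD _ b1; have := dD _ b2; rewrite /= scale0r addr0 !(addrC x) !addrK.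
rewrite [in X in _ -> X]deriveD_dir// [in 'D_(h *: w) _ _]deriveZ_dir//.
set p := 'D_v f _; set q := 'D_v f x; set r := 'D_v f _; set cc := 'D_w _ _; set D := 'D_(c *: v) _ _.
move=> E1 E2.
have n1 : `|c *: v| <= h * N by have := nk c 0 hc h00; rewrite scale0r addr0.
have n2 : `|c *: v + h *: w| <= h * N by exact: nk.
have E1' : `|p - q - D| <= e' * (h * N) by apply: le_trans E1 _; rewrite ler_pM2l.
have E2' : `|r - q - (D + h *: cc)| <= e' * (h * N) by apply: le_trans E2 _; rewrite ler_pM2l.
have -> : (r - p) * h - h ^+ 2 * cc = h * ((r - q - (D + h *: cc)) - (p - q - D)).
  by rewrite /GRing.scale/=; ring.
rewrite normrM gtr0_norm// expr2 mulrCA ler_pM2l//.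
apply: (le_trans (ler_normB _ _)); apply: (le_trans (lerD E2' E1')).
rewrite -mulr2n -mulr_natr /e' le_eqVlt; apply/orP; left; apply/eqP.
by field; rewrite gt_eqF.
Qed.

(** Young's theorem: the second difference is symmetric in [v] and [w], and both
iterated derivatives are its limit. *)
Lemma derive_swap_scalar (V : normedModType R) (f : V -> R) (x v w : V) :
  (\forall y \near x, differentiable f y) ->
  differentiable (fun y => 'D_v f y) x -> differentiable (fun y => 'D_w f y) x ->
  'D_w (fun y => 'D_v f y) x = 'D_v (fun y => 'D_w f y) x.
Proof.
move=> df dv dw; apply/eqP; rewrite -subr_eq0 -normr_le0.
apply/ler_addgt0Pr => e e0; rewrite add0r.
have e20 : 0 < e / 2 by rewrite divr_gt0.
have [d1 d10 h1] := second_difference V f x v w (e / 2) df dv e20.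
have [d2 d20 h2] := second_difference V f x w v (e / 2) df dw e20.
pose h := Num.min d1 d2 / 2.
have m0 : 0 < Num.min d1 d2 by rewrite lt_min d10.
have h0 : 0 < h by rewrite divr_gt0.
have hm : h < Num.min d1 d2 by rewrite /h ltr_pdivrMr// mulr_natr mulr2n ltrDl.
have := hm; rewrite lt_min => /andP[hd1 hd2].
have := h1 h; rewrite h0 hd1 => /(_ isT) k1.
have := h2 h; rewrite h0 hd2 => /(_ isT) k2.
have h20 : 0 < h ^+ 2 by rewrite exprn_gt0.
rewrite -(ler_pM2l h20) -{1}(gtr0_norm h20) -normrM mulrBr.
pose A := f (x + h *: v + h *: w) - f (x + h *: v) - f (x + h *: w) + f x.
rewrite -/A in k1.
have AB : f (x + h *: w + h *: v) - f (x + h *: w) - f (x + h *: v) + f x = A.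
  by rewrite /A (addrAC x); ring.
rewrite AB in k2.
move: k1 k2; set a := 'D_w _ x; set b := 'D_v _ x => k1 k2.
have -> : h ^+ 2 * a - h ^+ 2 * b = (A - h ^+ 2 * b) - (A - h ^+ 2 * a) by ring.
apply: (le_trans (ler_normB _ _)); apply: (le_trans (lerD k2 k1)).
by rewrite -mulrDl -splitr mulrC.
Qed.

Lemma derive_swap m n (Q : set 'rV[R]_m) (F : 'rV[R]_m -> 'rV[R]_n) x v w :
  open Q -> smooth_on Q F -> Q x ->
  'D_w (fun y => 'D_v F y) x = 'D_v (fun y => 'D_w F y) x.
Proof.
move=> opQ sF Qx.
have nQ : \forall y \near x, Q y by exact: open_nbhs_nbhs.
have dF y : Q y -> differentiable F y := smooth_on_differentiable _ _ _ _ _ sF.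
have dFi i y : Q y -> differentiable (fun z => F z 0 i) y.
  move=> Qy; apply: (differentiable_comp (g := fun M : 'rV[R]_n => M 0 i)) => //.
    exact: dF.
  exact: differentiable_coord.
have E i u : {near x, (fun y => 'D_u F y 0 i) =1 (fun y => 'D_u (fun z => F z 0 i) y)}.
  apply: filterS nQ => y Qy; rewrite derive_mx ?mxE//.
  exact/diff_derivable/dF.
have dDi i u : differentiable (fun y => 'D_u F y 0 i) x.
  apply: (differentiable_comp (g := fun M : 'rV[R]_n => M 0 i)).
    exact: smooth_on_derive sF Qx.
  exact: differentiable_coord.
have dd u e i : 'D_e (fun y => 'D_u F y) x 0 i = 'D_e (fun y => 'D_u F y 0 i) x.
  rewrite derive_mx ?mxE//; apply: diff_derivable.
  exact: smooth_on_derive sF Qx.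
apply/rowP => i.
apply: (etrans (dd v w i)); apply: (etrans (near_eq_derive _ (E i v))).
apply/esym; apply: (etrans (dd w v i)); apply: (etrans (near_eq_derive _ (E i w))).
apply/esym; apply: derive_swap_scalar.
- by apply: filterS nQ; exact: dFi.
- exact: near_eq_differentiable (E i v) (dDi i v).
- exact: near_eq_differentiable (E i w) (dDi i w).
Qed.

(** Strict differentiability of a C^1 function, by the mean value theorem on
segments. The two endpoints move independently near [x], which is what the
increment of the metric between two nearby curves requires. *)
Lemma strict_diff m (Q : set 'rV[R]_m) (f : 'rV[R]_m -> R) x e :
  open Q -> Q x -> (forall y, Q y -> differentiable f y) ->
  (forall i, {for x, continuous (fun y => 'D_(delta_mx 0 i) f y)}) -> 0 < e ->
  exists2 d, 0 < d & forall y z, ball x d y -> ball x d z ->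
    `|f z - f y - 'D_(z - y) f x| <= e * `|z - y|.
Proof.
move=> opQ Qx df cf e0.
have nQ : \forall y \near x, Q y by exact: open_nbhs_nbhs.
pose e' := e / (m%:R + 1).
have m0 : 0 < m%:R + 1 :> R by rewrite ltr_wpDl.
have e'0 : 0 < e' by rewrite divr_gt0.
have c i : \forall y \near x, `|'D_(delta_mx 0 i) f x - 'D_(delta_mx 0 i) f y| < e'.
  by have := cf i; move=> /cvgrPdist_lt; apply.
have : \forall y \near x, forall i, `|'D_(delta_mx 0 i) f x - 'D_(delta_mx 0 i) f y| < e'.
  exact: (@filter_forall _ _
    (fun i y => `|'D_(delta_mx 0 i) f x - 'D_(delta_mx 0 i) f y| < e') (nbhs x) _ c).
move=> /(filterI nQ) /nbhs_ballP[d /= d0 dP]; exists d => // y z yd zd.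
pose phi t := f (y + t *: (z - y)).
have inb t : 0 <= t <= 1 -> ball x d (y + t *: (z - y)).
  move=> /andP[t0 t1]; move: yd zd; rewrite -!ball_normE/= => yd zd.
  rewrite (_ : x - _ = (1 - t) *: (x - y) + t *: (x - z)); last first.
    by rewrite scalerBl scale1r !scalerBr; apply/rowP => i; rewrite !mxE; ring.
  apply: (le_lt_trans (ler_normD _ _)); rewrite !normrZ !ger0_norm ?subr_ge0//.
  rewrite [X in _ < X](_ : d = (1 - t) * d + t * d); last by ring.
  move: t0; rewrite le_eqVlt => /predU1P[<-|t0].
    by rewrite subr0 !mul0r !addr0 !mul1r.
  apply: ler_ltD; last by rewrite ltr_pM2l.
  by rewrite ler_wpM2l ?subr_ge0// ltW.
have [||t] := @MVT R phi (fun t => 'D_(z - y) f (y + t *: (z - y))) 0 1 ltr01.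
- move=> t; rewrite in_itv/= => /andP[t0 t1]; apply: is_derive_line.
  by apply/diff_derivable/df; have [] := dP _ (inb t _); rewrite ?ltW.
- apply: derivable_within_continuous => t; rewrite in_itv/= => ht.
  have [] // := is_derive_line f y (z - y) t _.
  by apply/diff_derivable/df; have [] := dP _ (inb t ht).
rewrite in_itv/= => /andP[t0 t1].
rewrite /phi scale1r scale0r addr0 (addrC y (z - y)) subrK subr0 mulr1 => ->.
have ht : 0 <= t <= 1 by rewrite !ltW.
have [Qt tP] := dP _ (inb t ht).
set p := y + _ in Qt tP *.
rewrite derive_partial; last exact: df.
rewrite [X in _ - X]derive_partial; last exact: df.
rewrite -sumrB; apply: (le_trans (ler_norm_sum _ _ _)).
apply: (@le_trans _ _ (\sum_(i < m) `|z - y| * e')).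
  apply: ler_sum => i _; rewrite -scalerBr normrZ; apply: ler_pM => //.
    exact: rV_coord_le.
  by rewrite distrC ltW.
rewrite sumr_const card_ord -mulr_natl mulrCA mulrC ler_wpM2r//.
by rewrite /e' mulrA ler_pdivrMr// mulrC (ler_pM2l e0) lerDl.
Qed.

End smoothness.

(** * Linear algebra of inner products *)

Section inner_product.
Context {R : realType}.

Lemma innerDl n (G : 'M[R]_n) u v w : inner G (u + v) w = inner G u w + inner G v w.
Proof. by rewrite /inner !mulmxDl mxE. Qed.

Lemma innerDr n (G : 'M[R]_n) u v w : inner G u (v + w) = inner G u v + inner G u w.
Proof. by rewrite /inner linearD mulmxDr mxE. Qed.

Lemma innerZl n (G : 'M[R]_n) k u v : inner G (k *: u) v = k * inner G u v.
Proof. by rewrite /inner -!scalemxAl mxE. Qed.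

Lemma innerZr n (G : 'M[R]_n) k u v : inner G u (k *: v) = k * inner G u v.
Proof. by rewrite /inner linearZ -scalemxAr mxE. Qed.

Lemma innerBl n (G : 'M[R]_n) u v w : inner G (u - v) w = inner G u w - inner G v w.
Proof. by rewrite innerDl -scaleN1r innerZl mulN1r. Qed.

Lemma innerBr n (G : 'M[R]_n) u v w : inner G u (v - w) = inner G u v - inner G u w.
Proof. by rewrite innerDr -scaleN1r innerZr mulN1r. Qed.

Lemma inner_mxD n (G H : 'M[R]_n) u v : inner (G + H) u v = inner G u v + inner H u v.
Proof. by rewrite /inner mulmxDr mulmxDl mxE. Qed.

Lemma inner_mxZ n k (G : 'M[R]_n) u v : inner (k *: G) u v = k * inner G u v.
Proof. by rewrite /inner -scalemxAr -scalemxAl mxE. Qed.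

Lemma inner_mxB n (G H : 'M[R]_n) u v : inner (G - H) u v = inner G u v - inner H u v.
Proof. by rewrite inner_mxD -scaleN1r inner_mxZ mulN1r. Qed.

Lemma innerC n (G : 'M[R]_n) u v : G^T = G -> inner G u v = inner G v u.
Proof.
move=> Gs; rewrite /inner; transitivity ((u *m G *m v^T)^T 0 0); first by rewrite [RHS]mxE.
by rewrite !trmx_mul trmxK Gs mulmxA.
Qed.

Lemma inner_mulmx m n (G : 'M[R]_n) (J : 'M[R]_(m, n)) (u v : 'rV[R]_m) :
  inner G (u *m J) (v *m J) = inner (J *m G *m J^T) u v.
Proof. by rewrite /inner trmx_mul !mulmxA. Qed.

Lemma innerE n (G : 'M[R]_n) u v : inner G u v = \sum_i \sum_j u 0 i * G i j * v 0 j.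
Proof.
rewrite /inner mxE exchange_big; apply: eq_bigr => j _.
by rewrite !mxE mulr_suml.
Qed.

Lemma inner1_ge0 n (u : 'rV[R]_n) : 0 <= inner 1%:M u u.
Proof.
by rewrite /inner mulmx1 mxE; apply: sumr_ge0 => i _; rewrite mxE -expr2 sqr_ge0.
Qed.

Lemma inner1_gt0 n (u : 'rV[R]_n) : u != 0 -> 0 < inner 1%:M u u.
Proof.
move=> u0; rewrite lt_neqAle inner1_ge0 andbT eq_sym; apply: contra_neq u0.
rewrite /inner mulmx1 mxE => /psumr_eq0P h; apply/rowP => i; rewrite mxE.
have h0 j : true -> 0 <= u 0 j * u^T j 0 by move=> _; rewrite mxE -expr2 sqr_ge0.
by have := h h0 i isT; rewrite mxE -expr2 => /eqP; rewrite sqrf_eq0 => /eqP.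
Qed.

Definition posdef n (G : 'M[R]_n) := forall v, v != 0 -> 0 < inner G v v.

Lemma posdef_ge0 n (G : 'M[R]_n) v : posdef n G -> 0 <= inner G v v.
Proof.
move=> pG; have [->|v0] := eqVneq v 0; last exact/ltW/pG.
by rewrite /inner !mul0mx mxE.
Qed.

Lemma posdef_unitmx n (G : 'M[R]_n) : posdef n G -> G \in unitmx.
Proof.
move=> pG; rewrite -row_free_unit; apply: inj_row_free => v vG.
apply: contrapT => /eqP v0; have := pG v v0.
by rewrite /inner vG mul0mx mxE ltxx.
Qed.

Lemma posdef_gram m n (G : 'M[R]_n) (T : 'M[R]_(m, n)) :
  posdef n G -> row_free T -> posdef m (T *m G *m T^T).
Proof.
move=> pG Tf v v0; rewrite -inner_mulmx; apply: pG.
by apply: contra_neq v0 => vT; apply: (row_free_inj Tf); rewrite vT mul0mx.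
Qed.

(** Pythagoras: the second term on the right is the squared norm of the tangential
part. It involves [z] only through its inner products with the rows of [T]. *)
Lemma inner_normal_part m n (G : 'M[R]_n) (T : 'M[R]_(m, n)) z :
  G^T = G -> posdef n G -> row_free T ->
  inner G (normal_part G T z) (normal_part G T z) =
  inner G z z - inner (invmx (T *m G *m T^T)) (z *m G *m T^T) (z *m G *m T^T).
Proof.
move=> Gs pG Tf; set P := T *m G *m T^T; set b := z *m G *m T^T.
have uP : P \in unitmx by exact/posdef_unitmx/posdef_gram.
have Ps : P^T = P by rewrite /P !trmx_mul trmxK Gs mulmxA.
have bT : (T *m G) *m z^T = b^T by rewrite /b !trmx_mul trmxK Gs mulmxA.
rewrite /normal_part -/P -/b innerBl !innerBr.
have -> : inner G z (b *m invmx P *m T) = inner (invmx P) b b.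
  by rewrite /inner !trmx_mul trmx_inv Ps !mulmxA.
have -> : inner G (b *m invmx P *m T) z = inner (invmx P) b b.
  by rewrite /inner -(mulmxA _ T) -(mulmxA _ (T *m G)) bT.
rewrite inner_mulmx -/P inner_mulmx trmx_inv Ps mulVmx// mul1mx.
by ring.
Qed.

Lemma normal_part_orth m n (G : 'M[R]_n) (T : 'M[R]_(m, n)) z :
  posdef n G -> row_free T -> normal_part G T z *m G *m T^T = 0.
Proof.
move=> pG Tf; rewrite /normal_part !mulmxBl.
set P := T *m G *m T^T; set b := z *m G *m T^T.
have -> : b *m invmx P *m T *m G *m T^T = b *m invmx P *m P by rewrite /P !mulmxA.
by rewrite mulmxKV ?subrr//; exact/posdef_unitmx/posdef_gram.
Qed.

Lemma inner_unit_le n (G : 'M[R]_n) nu N : G^T = G -> posdef n G ->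
  inner G nu nu = 1 -> inner G nu N ^+ 2 <= inner G N N.
Proof.
move=> Gs pG nu1; have := posdef_ge0 n G (N - inner G nu N *: nu) pG.
rewrite innerBl !innerBr !innerZl !innerZr nu1 (innerC _ _ N nu)//.
by rewrite mulr1 subrr subr0 -expr2 subr_ge0.
Qed.

(** In codimension one a normal vector is a multiple of the unit normal: the rows
of [T] together with [nu] form a basis. *)
Lemma inner_unit_eq m n (G : 'M[R]_n) (T : 'M[R]_(m, n)) nu N :
  (m + 1 = n)%N ->
  G^T = G -> posdef n G -> row_free T -> inner G nu nu = 1 ->
  nu *m G *m T^T = 0 -> N *m G *m T^T = 0 ->
  inner G N N = inner G nu N ^+ 2.
Proof.
move=> mn Gs pG Tf nu1 nuT NT.
set q := N - inner G nu N *: nu.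
have qT : q *m G *m T^T = 0 by rewrite /q !mulmxBl -!scalemxAl NT nuT scaler0 subrr.
have qnu : inner G q nu = 0.
  by rewrite /q innerBl innerZl nu1 mulr1 (innerC _ _ N)// subrr.
have Vf : row_free (col_mx T nu).
  apply: inj_row_free => v; rewrite -[v]hsubmxK mul_row_col => h.
  have h2 : rsubmx v = 0.
    have : inner G (lsubmx v *m T + rsubmx v *m nu) nu = 0.
      by rewrite h /inner !mul0mx mxE.
    rewrite [rsubmx v]mx11_scalar mul_scalar_mx innerDl innerZl nu1 mulr1.
    have -> : inner G (lsubmx v *m T) nu = 0.
      by rewrite innerC// /inner trmx_mul mulmxA nuT mul0mx mxE.
    by rewrite add0r => ->; exact: raddf0.
  move: h; rewrite h2 mul0mx addr0 => h1.
  have h1' : lsubmx v = 0 by apply: (row_free_inj Tf); rewrite h1 mul0mx.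
  by rewrite h1' row_mx0.
have Vfull : row_full (col_mx T nu) by apply/eqP; exact: etrans (eqP Vf) mn.
have /submxP[y qE] : (q <= col_mx T nu)%MS by exact: submx_full.
have q0 : inner G q q = 0.
  rewrite {2}qE /inner trmx_mul mulmxA tr_col_mx mul_mx_row qT.
  have -> : q *m G *m nu^T = 0.
    by apply/matrixP => i j; rewrite !ord1 [RHS]mxE.
  by rewrite row_mx0 mul0mx mxE.
have {q0}q0 : q = 0.
  by apply: contrapT => /eqP /pG; rewrite q0 ltxx.
have -> : N = inner G nu N *: nu by apply/eqP; rewrite -subr_eq0; exact/eqP.
by rewrite !innerZl !innerZr nu1 !mulr1 -expr2.
Qed.

End inner_product.

(** * The Levi-Civita connection in coordinates *)

Section levi_civita.
Context {R : realType}.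

Lemma derive_entry n (G : 'rV[R]_n -> 'M[R]_n) x v i j : differentiable G x ->
  'D_v (fun y => G y i j) x = ('D_v G x) i j.
Proof. by move=> dG; rewrite derive_mx ?mxE//; exact: diff_derivable. Qed.

(** Contracting the inverse metric in the Christoffel symbols. The right-hand
side is <nabla_X X, Z> for constant fields. *)
Lemma inner_christoffel n (G : 'rV[R]_n -> 'M[R]_n) x (X Z : 'rV[R]_n) :
  differentiable G x -> (G x)^T = G x -> G x \in unitmx ->
  inner (G x) (\row_k \sum_(i < n) \sum_(j < n)
      christoffel G x k i j * X 0 i * X 0 j) Z =
  inner ('D_X G x) X Z - 2^-1 * inner ('D_Z G x) X X.
Proof.
move=> dG Gs uG.
pose E := 2 *: (X *m 'D_X G x) - \row_l inner ('D_(delta_mx 0 l) G x) X X.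
have DX j l : ('D_X G x) j l = \sum_i X 0 i * ('D_(delta_mx 0 i) G x) j l.
  by rewrite derive_partial// summxE; apply: eq_bigr => i _; rewrite mxE.
have -> : (\row_k \sum_(i < n) \sum_(j < n) christoffel G x k i j * X 0 i * X 0 j)
    = 2^-1 *: (E *m (invmx (G x))^T).
  apply/rowP => k; rewrite !mxE.
  under eq_bigr => i _.
    under eq_bigr => j _.
      rewrite /christoffel -!mulrA mulr_suml mulr_sumr.
      over.
    rewrite exchange_big/=.
    over.
  rewrite exchange_big/= mulr_sumr; apply: eq_bigr => l _.
  rewrite !mxE innerE.
  transitivity (2^-1 * invmx (G x) k l * \sum_i \sum_j
     (X 0 i * X 0 j * ('D_(delta_mx 0 i) G x) j l
      + X 0 i * X 0 j * ('D_(delta_mx 0 j) G x) i l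
      - X 0 i * ('D_(delta_mx 0 l) G x) i j * X 0 j)).
    rewrite mulr_sumr; apply: eq_bigr => i _; rewrite mulr_sumr; apply: eq_bigr => j _.
    by rewrite !derive_entry//; ring.
  rewrite [X in _ = _ * X]mulrC [RHS]mulrA; congr (_ * _).
  under eq_bigr do rewrite sumrB big_split/=.
  rewrite sumrB big_split/=; congr (_ - _).
  rewrite mulr_natl mulr2n exchange_big/=; congr (_ + _); apply: eq_bigr => j _.
    by rewrite [X in _ = _ * X]DX mulr_sumr; apply: eq_bigr => i _; rewrite mulrCA mulrA.
  by rewrite [X in _ = _ * X]DX mulr_sumr; apply: eq_bigr => i _; rewrite mulrA.
have -> : inner (G x) (2^-1 *: (E *m (invmx (G x))^T)) Z = 2^-1 * (E *m Z^T) 0 0.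
  rewrite innerZl /inner trmx_inv Gs; congr (_ * _ 0 0).
  by rewrite mulmxKV.
rewrite /E mulmxBl -scalemxAl mxE [X in X + _]mxE mulrDr mulKf//; congr (_ + _).
rewrite mxE mulrN; congr (- (_ * _)).
rewrite mxE derive_partial//.
transitivity (\sum_l Z 0 l * inner ('D_(delta_mx 0 l) G x) X X).
  by apply: eq_bigr => l _; rewrite !mxE mulrC.
rewrite /inner mulmx_sumr mulmx_suml summxE; apply: eq_bigr => l _.
by rewrite -scalemxAr -scalemxAl [RHS]mxE.
Qed.

(** Koszul's formula along a map. The right-hand side depends on the pulled back
metric only, and so takes the same value for two maps that induce the same metric.
The symmetry of the second derivatives of [F] is the absence of torsion. *)
Lemma inner_nabla m n (Q : set 'rV[R]_m) (F : 'rV[R]_m -> 'rV[R]_n)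
    (G : 'rV[R]_n -> 'M[R]_n) (w v e : 'rV[R]_m) :
  open Q -> smooth_on Q F -> Q w ->
  differentiable G (F w) -> (G (F w))^T = G (F w) -> G (F w) \in unitmx ->
  inner (G (F w)) (nabla G F w v v) ('D_e F w) =
  'D_v (fun y => inner (G (F y)) ('D_v F y) ('D_e F y)) w
  - 2^-1 * 'D_e (fun y => inner (G (F y)) ('D_v F y) ('D_v F y)) w.
Proof.
move=> opQ sF Qw dG Gs uG.
have dF : differentiable F w := smooth_on_differentiable _ _ _ _ _ sF Qw.
have hF d : is_derive w d F ('D_d F w) by exact/derivableP/diff_derivable.
have hG d : is_derive w d (fun y => G (F y)) ('D_('D_d F w) G (F w)).
  exact: (is_derive_comp_diff _ _ _ _ F G w d _ (hF d) dF dG).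
have hD d d' : is_derive w d (fun y => 'D_d' F y) ('D_d (fun y => 'D_d' F y) w).
  exact/derivableP/diff_derivable/(smooth_on_derive _ _ _ _ _ _ opQ sF Qw).
pose X := 'D_v F w; pose E := 'D_e F w.
pose XX := 'D_v (fun y => 'D_v F y) w; pose XE := 'D_v (fun y => 'D_e F y) w.
have swap : 'D_e (fun y => 'D_v F y) w = XE by exact: derive_swap opQ sF Qw.
have he : is_derive w e (fun y => 'D_v F y) XE by rewrite -swap; exact: hD.
have e1 : 'D_v (fun y => inner (G (F y)) ('D_v F y) ('D_e F y)) w =
    inner ('D_X G (F w)) X E + inner (G (F w)) XX E + inner (G (F w)) X XE.
  have := is_derive_inner _ _ _ _ _ _ _ _ _ (hG v) (hD v v) (hD v e).
  by move=> [_ h]; exact: h.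
have e2 : 'D_e (fun y => inner (G (F y)) ('D_v F y) ('D_v F y)) w =
    inner ('D_E G (F w)) X X + inner (G (F w)) XE X + inner (G (F w)) X XE.
  have := is_derive_inner _ _ _ _ _ _ _ _ _ (hG e) he he.
  by move=> [_ h]; exact: h.
have h1 : inner (G (F w)) (nabla G F w v v) E =
    inner (G (F w)) XX E + (inner ('D_X G (F w)) X E - 2^-1 * inner ('D_E G (F w)) X X).
  by rewrite /nabla innerDl; congr (_ + _); exact: inner_christoffel.
have h2 : inner (G (F w)) XE X = inner (G (F w)) X XE by exact: innerC.
apply: (etrans h1); apply: (etrans _ (esym (congr2 (fun a b => a - 2^-1 * b) e1 e2))).
clearbody X E XX XE; rewrite h2.
by field.
Qed.

End levi_civita.

(** * Comparison of second fundamental forms *)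

Section comparison.
Context {R : realType}.

Lemma jacobianE m n (F : 'rV[R]_m -> 'rV[R]_n) w e : differentiable F w ->
  e *m 'J F w = 'D_e F w.
Proof. by move=> dF; rewrite deriveEjacobian. Qed.

Lemma inner_pullback m n (G : 'rV[R]_n -> 'M[R]_n) (F : 'rV[R]_m -> 'rV[R]_n) w a b :
  differentiable F w ->
  inner (pullback G F w) a b = inner (G (F w)) ('D_a F w) ('D_b F w).
Proof. by move=> dF; rewrite -!jacobianE// inner_mulmx. Qed.

Lemma christoffel_flat n (x : 'rV[R]_n) k i j : christoffel (@flat R n) x k i j = 0.
Proof.
rewrite /christoffel big1 ?mulr0// => l _.
by rewrite /flat !derive_cst addr0 subr0 mulr0.
Qed.

Lemma nabla_flat m n (F : 'rV[R]_m -> 'rV[R]_n) w X Y :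
  nabla (@flat R n) F w X Y = 'D_X (fun y => 'D_Y F y) w.
Proof.
rewrite /nabla [X in _ + X](_ : _ = 0) ?addr0//; apply/rowP => k.
rewrite !mxE big1// => i _; rewrite big1// => j _.
by rewrite christoffel_flat !mul0r.
Qed.

Lemma posdef1 n : posdef (R := R) n 1%:M.
Proof. by move=> v; exact: inner1_gt0. Qed.

(** Gauss: the tangential part of the acceleration is intrinsic. *)
Lemma tangential_nabla m n (Q : set 'rV[R]_m) (F y : 'rV[R]_m -> 'rV[R]_n)
    (G : 'rV[R]_n -> 'M[R]_n) (w v : 'rV[R]_m) :
  open Q -> smooth_on Q F -> smooth_on Q y -> Q w ->
  differentiable G (F w) -> (G (F w))^T = G (F w) -> posdef n (G (F w)) ->
  (forall w', Q w' -> pullback (@flat R n) y w' = pullback G F w') ->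
  nabla (@flat R n) y w v v *m 1%:M *m ('J y w)^T =
  nabla G F w v v *m G (F w) *m ('J F w)^T.
Proof.
move=> opQ sF sy Qw dG Gs pG iso.
have dF w' : Q w' -> differentiable F w' := smooth_on_differentiable _ _ _ _ _ sF.
have dy w' : Q w' -> differentiable y w' := smooth_on_differentiable _ _ _ _ _ sy.
have nQ : \forall w' \near w, Q w' by exact: open_nbhs_nbhs.
have iso2 a b : {near w, (fun w' => inner (flat (y w')) ('D_a y w') ('D_b y w')) =1
    (fun w' => inner (G (F w')) ('D_a F w') ('D_b F w'))}.
  apply: filterS nQ => w' Qw'; rewrite -!inner_pullback ?iso//.
  - exact: dF.
  - exact: dy.
have hrow p (k : 'I_p) (A : 'M[R]_n) (J : 'M[R]_(p, n)) (z : 'rV[R]_n) :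
    (z *m A *m J^T) 0 k = inner A z (delta_mx 0 k *m J).
  by rewrite /inner -rowE !mxE; apply: eq_bigr => j _; rewrite !mxE.
apply/rowP => k; apply: (etrans (hrow _ k _ _ _)); apply: (etrans _ (esym (hrow _ k _ _ _))).
have jF := jacobianE _ _ F w (delta_mx 0 k) (dF w Qw).
have jy := jacobianE _ _ y w (delta_mx 0 k) (dy w Qw).
apply: (etrans (congr1 (inner _ _) jy)); apply: (etrans _ (esym (congr1 (inner _ _) jF))).
have A1 := inner_nabla _ _ Q F G w v (delta_mx 0 k) opQ sF Qw dG Gs (posdef_unitmx _ _ pG).
have dfl : differentiable (@flat R n) (y w) by exact: differentiable_cst.
have A2 := inner_nabla _ _ Q y (@flat R n) w v (delta_mx 0 k) opQ sy Qw dfl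
  (trmx1 _ _) (unitmx1 _ _).
apply: (etrans A2); apply: (etrans _ (esym A1)).
exact: (congr2 (fun a b => a - 2^-1 * b)
  (near_eq_derive _ (iso2 v (delta_mx 0 k))) (near_eq_derive _ (iso2 v v))).
Qed.

Lemma lt_of_eq_normal_parts (hb2 h2 NN Zb Zz B : R) :
  hb2 = Zb - B -> hb2 < h2 -> h2 <= NN -> NN = Zz - B -> Zb < Zz.
Proof. by lra. Qed.

(** Subtracting from both squared norms the common tangential contribution leaves
the squares of the scalar second fundamental forms; for [F] Bessel's inequality is
enough, for [y] equality is needed. *)
Lemma acceleration_lt n (Q : set 'rV[R]_n.-1) (F y : 'rV[R]_n.-1 -> 'rV[R]_n)
    (G : 'rV[R]_n -> 'M[R]_n) (w v : 'rV[R]_n.-1) nu nubar :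
  (0 < n)%N ->
  open Q -> smooth_on Q F -> smooth_on Q y -> Q w ->
  row_free ('J F w) -> row_free ('J y w) ->
  differentiable G (F w) -> (G (F w))^T = G (F w) -> posdef n (G (F w)) ->
  (forall w', Q w' -> pullback (@flat R n) y w' = pullback G F w') ->
  unit_normal G F w nu -> unit_normal (@flat R n) y w nubar ->
  `|scalar_second_ff (@flat R n) y w nubar v v| < `|scalar_second_ff G F w nu v v| ->
  inner 1%:M (nabla (@flat R n) y w v v) (nabla (@flat R n) y w v v) <
  inner (G (F w)) (nabla G F w v v) (nabla G F w v v).
Proof.
move=> n0 opQ sF sy Qw fF fy dG Gs pG iso [nu1 nuT] [nub1 nubT].
have tan := tangential_nabla _ _ Q F y G w v opQ sF sy Qw dG Gs pG iso.
have Peq := iso w Qw; rewrite /pullback /flat in Peq.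
rewrite /scalar_second_ff /second_ff /=.
set z := nabla G F w v v in tan *; set zb := nabla _ y w v v in tan *.
have EN := inner_normal_part _ _ _ _ z Gs pG fF.
have ENb := inner_normal_part _ _ _ _ zb (trmx1 _ _) (posdef1 n) fy.
rewrite Peq tan in ENb.
have hle := inner_unit_le _ _ nu (normal_part (G (F w)) ('J F w) z) Gs pG nu1.
have nT : nubar *m 1%:M *m ('J y w)^T = 0.
  apply/rowP => k; rewrite [RHS]mxE -(nubT (delta_mx 0 k)) /inner -rowE !mxE.
  by apply: eq_bigr => j _; rewrite !mxE.
have hbE := inner_unit_eq _ _ _ _ nubar (normal_part 1%:M ('J y w) zb) _
  (trmx1 _ _) (posdef1 n) fy nub1 nT (normal_part_orth _ _ _ _ zb (posdef1 n) fy).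
have {}hbE := hbE (etrans (addn1 _) (prednK n0)).
have sq (a b : R) : `|a| < `|b| -> a ^+ 2 < b ^+ 2.
  by move=> ab; rewrite -(real_normK (num_real a)) -(real_normK (num_real b)) ltr_pXn2r ?nnegrE.
move=> /sq lth.
exact: (lt_of_eq_normal_parts _ _ _ _ _ _ (etrans (esym hbE) ENb) lth hle EN).
Qed.

End comparison.

(** * Comparison along a curve *)

Lemma differentiable_eps (R : realType) (V W : normedModType R) (f : V -> W) x
    (df : {linear V -> W}) :
  continuous df ->
  (forall e, 0 < e -> \forall y \near x, `|f y - f x - df (y - x)| <= e * `|y - x|) ->
  differentiable f x /\ forall v, 'D_v f x = df v.
Proof.
move=> cdf fD.
have fE : f \o shift x = cst (f x) + df +o_ 0 id.
  apply/eqaddoP => e e0; have /nbhs_ballP[d /= d0 dP] := fD e e0.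
  apply/nbhs_ballP; exists d => //= y; rewrite -ball_normE/= sub0r normrN => yd.
  have := dP (y + x); rewrite -ball_normE/= opprD addrCA subrr addr0 normrN => /(_ yd).
  by rewrite !fctE/= addrK opprD addrA.
have dE : 'd f x = df :> (V -> W) by exact: diff_unique fE.
have dfx : differentiable f x by apply/diff_locallyP; rewrite dE.
by split => // v; rewrite deriveE// dE.
Qed.

Section curve_comparison.
Context {R : realType}.

Lemma is_derive1_eps (V : normedModType R) (f : R -> V) t df e :
  is_derive t (1 : R) f df -> 0 < e ->
  \forall s \near t, `|f s - f t - (s - t) *: df| <= e * `|s - t|.
Proof.
move=> [fd <-] e0; have dff : differentiable f t by exact/derivable1_diffP.
have := diff_eps f t e dff e0; apply: filterS => s.
have -> : 'D_(s - t) f t = (s - t) *: 'D_1 f t; last by [].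
by rewrite -(deriveZ_dir f t (s - t) (1 : R) dff) /GRing.scale/= mulr1.
Qed.

Lemma is_derive1_continuous (V : normedModType R) (f : R -> V) t df :
  is_derive t (1 : R) f df -> {for t, continuous f}.
Proof. by move=> [fd _]; exact/differentiable_continuous/derivable1_diffP. Qed.

Lemma mulmxr_differentiable m k (D : 'M[R]_(m, k)) x :
  differentiable (fun v : 'rV[R]_m => v *m D) x.
Proof.
rewrite (_ : (fun v : 'rV[R]_m => v *m D) = \sum_(i < m) (fun v : 'rV[R]_m => v 0 i *: row i D)).
  by apply: differentiable_sum => i; apply: differentiableZl; exact: differentiable_coord.
by apply/funext => v; rewrite fct_sumE mulmx_sum_row.
Qed.

Lemma diff_of_is_diff_within m k (u : 'rV[R]_m -> 'rV[R]_k) x D :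
  is_diff_within setT u x D -> differentiable u x /\ forall v, 'D_v u x = v *m D.
Proof.
move=> uD.
have cD : continuous (mulmxr D : 'rV[R]_m -> 'rV[R]_k).
  by move=> y; apply: (@differentiable_continuous _ _ _ y (fun v : 'rV[R]_m => v *m D)); exact: mulmxr_differentiable.
apply: (differentiable_eps R _ _ u x (mulmxr D) cD) => d d0.
by have := uD d d0; apply: filterS => y; apply.
Qed.

Lemma inner1_le n (u v : 'rV[R]_n) : `|inner 1%:M u v| <= n%:R * (`|u| * `|v|).
Proof.
rewrite /inner mulmx1 mxE; apply: (le_trans (ler_norm_sum _ _ _)).
apply: (@le_trans _ _ (\sum_(i < n) `|u| * `|v|)); last by rewrite sumr_const card_ord mulr_natl.
apply: ler_sum => i _; rewrite mxE normrM; apply: ler_pM => //; exact: rV_coord_le.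
Qed.

Lemma is_derive_inner1 k (f : R -> 'rV[R]_k) (e : 'rV[R]_k) t df :
  is_derive t (1 : R) f df ->
  is_derive t (1 : R) (fun s => inner 1%:M e (f s)) (inner 1%:M e df).
Proof.
move=> hf; have h0 := is_derive_cst (1%:M : 'M[R]_k) t (1 : R).
have h1 := is_derive_cst e t (1 : R).
have [h2 h3] := is_derive_inner _ _ _ _ _ _ _ _ _ h0 h1 hf.
apply: DeriveDef; first exact: h2.
by apply: (etrans h3); rewrite /inner !(mulmx0, mul0mx) mxE !add0r.
Qed.

(** A Lipschitz map that is differentiable at almost all points of a curve obeys
along it the bound that the chain rule would give at every time. The
increment of minus [g] dominates that of <e, u>. *)
Lemma curve_comparison n k (u : 'rV[R]_n -> 'rV[R]_k) (gam dgam : R -> 'rV[R]_n)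
    (e : 'rV[R]_k) (g dg : R -> R) (a b C L : R) (N : set R) (B : set 'rV[R]_n) :
  a <= b -> 0 <= L -> 0 <= C ->
  (forall t, a <= t <= b -> is_derive t (1 : R) gam (dgam t)) ->
  (forall t, a <= t <= b -> `|dgam t| <= C) ->
  (forall t, a <= t <= b -> is_derive t (1 : R) g (dg t)) ->
  (forall t, a <= t <= b -> dg t <= C) ->
  open B -> (forall t, a <= t <= b -> B (gam t)) ->
  (forall x y, B x -> B y -> `|u x - u y| <= L * `|x - y|) ->
  (@lebesgue_measure R).-negligible N ->
  (forall t, a <= t <= b -> ~ N t -> exists2 D, is_diff_within setT u (gam t) D &
     inner 1%:M e (dgam t *m D) + dg t <= 0) ->
  inner 1%:M e (u (gam b)) + g b <= inner 1%:M e (u (gam a)) + g a.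
Proof.
move=> ab L0 C0 dga bga dg_ bg opB Bga uL negN good.
have cu x : B x -> {for x, continuous u}.
  move=> Bx; suff : u z @[z --> x] --> u x by [].
  apply/(@cvgrPdist_lt _ _ _ (nbhs x)) => d d0.
  have nB : nbhs x B by exact: open_nbhs_nbhs.
  have L1 : 0 < L + 1 by exact: ltr_wpDl.
  have d'0 : 0 < d / (L + 1) by exact: divr_gt0.
  have : \forall y \near x, `|x - y| < d / (L + 1).
    have := nbhsx_ballx x _ d'0; apply: filterS => y; rewrite -ball_normE; exact.
  move=> nx; near=> y; have By : B y by near: y.
  have xy : `|x - y| < d / (L + 1) by near: y.
  apply: (le_lt_trans (uL _ _ Bx By)); apply: (@le_lt_trans _ _ ((L + 1) * `|x - y|)).
    by apply: ler_wpM2r => //; rewrite lerDl.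
  by rewrite mulrC -ltr_pdivlMr.
have ce (E : 'rV[R]_k) : {for E, continuous (fun v : 'rV[R]_k => inner 1%:M e v)}.
  rewrite (_ : (fun v => _) = (fun v : 'rV[R]_k => (v *m e^T) 0 0)).
    apply: (@differentiable_continuous _ _ _ E).
    apply: (differentiable_comp (f := fun v : 'rV[R]_k => v *m e^T) (g := fun M : 'M[R]_1 => M 0 0)).
      exact: mulmxr_differentiable.
    exact: differentiable_coord.
  by apply/funext => v; rewrite innerC ?trmx1// /inner mulmx1.
pose K := k%:R * (`|e| * (L * (C + 1))) + (C + 1).
have K0 : 0 <= K by rewrite !addr_ge0 ?mulr_ge0 ?addr_ge0.
apply: (@ae_nonincr_le R (fun t => inner 1%:M e (u (gam t)) + g t) a b K N) => //.
- move=> t tab; apply: continuousD; last exact: is_derive1_continuous (dg_ t tab).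
  apply: (@continuous_comp _ _ _ (u \o gam) (fun v => inner 1%:M e v) t); last exact: ce.
  apply: (@continuous_comp _ _ _ gam u t); first exact: is_derive1_continuous (dga t tab).
  exact/cu/Bga.
- move=> t /andP[at_ tb]; have tab : a <= t <= b by rewrite at_ ltW.
  have nB : \forall s \near t, B (gam s).
    apply: (is_derive1_continuous _ _ _ _ (dga t tab)).
    by apply: open_nbhs_nbhs; split => //; exact: Bga.
  have n1 := is_derive1_eps _ _ _ _ _ (dga t tab) ltr01.
  have n2 := is_derive1_eps _ _ _ _ _ (dg_ t tab) ltr01.
  near=> s => ts; have Bs : B (gam s) by near: s.
  have h1 : `|gam s - gam t - (s - t) *: dgam t| <= 1 * `|s - t| by near: s.
  have h2 : `|g s - g t - (s - t) *: dg t| <= 1 * `|s - t| by near: s.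
  have st0 : 0 < s - t by rewrite subr_gt0.
  rewrite (gtr0_norm st0) mul1r in h1; rewrite (gtr0_norm st0) mul1r in h2.
  have h3 : `|gam s - gam t| <= (C + 1) * (s - t).
    rewrite -(subrK ((s - t) *: dgam t) (gam s - gam t)) mulrDl mul1r addrC.
    apply: (le_trans (ler_normD _ _)); apply: lerD => //.
    by rewrite normrZ gtr0_norm// mulrC ler_pM2r// bga.
  have h4 : `|inner 1%:M e (u (gam s) - u (gam t))| <= k%:R * (`|e| * (L * (C + 1))) * (s - t).
    apply: (le_trans (inner1_le _ _ _)); rewrite -!mulrA ler_wpM2l// ler_wpM2l//.
    apply: (le_trans (uL _ _ Bs (Bga t tab))); rewrite ler_wpM2l//.
  have h5 : g s - g t <= (C + 1) * (s - t).
    have := le_trans (ler_norm _) h2; rewrite /GRing.scale/= => h6.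
    have h7 : (s - t) * dg t <= (s - t) * C by rewrite ler_pM2l// bg.
    rewrite lerBlDr in h6; apply: (le_trans h6).
    by rewrite [X in _ <= X]mulrDl mul1r [X in _ <= X]addrC lerD2l [C * _]mulrC.
  rewrite /= opprD addrACA -innerBr /K [X in _ <= X]mulrDl.
  by apply: lerD => //; exact: le_trans (ler_norm _) h4.
- move=> t /andP[at_ tb] Nt d d0; have tab : a <= t <= b by rewrite at_ ltW.
  have [D uD Dle] := good t tab Nt.
  have [du duE] := diff_of_is_diff_within _ _ _ _ _ uD.
  have dgam_t : differentiable gam t by apply/derivable1_diffP; have [] := dga t tab.
  have hug : is_derive t (1 : R) (fun s => u (gam s)) (dgam t *m D).
    by rewrite -duE; exact: (is_derive_comp_diff _ _ _ _ gam u t _ _ (dga t tab) dgam_t du).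
  have hI := is_derive_inner1 _ _ e _ _ hug.
  have hf : is_derive t (1 : R) (fun s => inner 1%:M e (u (gam s)) + g s)
      (inner 1%:M e (dgam t *m D) + dg t).
    exact: (is_deriveD hI (dg_ t tab)).
  have n1 := is_derive1_eps _ _ _ _ _ hf d0.
  near=> s => ts; have st0 : 0 < s - t by rewrite subr_gt0.
  have h1 : `|(inner 1%:M e (u (gam s)) + g s) - (inner 1%:M e (u (gam t)) + g t)
      - (s - t) *: (inner 1%:M e (dgam t *m D) + dg t)| <= d * `|s - t| by near: s.
  rewrite (gtr0_norm st0) in h1.
  have := le_trans (ler_norm _) h1; rewrite lerBlDr => /le_trans; apply.
  by rewrite gerDl /GRing.scale/= pmulr_rle0.
Unshelve. all: by end_near. Qed.

End curve_comparison.

(** * First-order expansions *)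

Section estimates.
Context {R : realType}.

Lemma inner_le n (M : 'M[R]_n) (u v : 'rV[R]_n) :
  `|inner M u v| <= n%:R ^+ 2 * (`|M| * (`|u| * `|v|)).
Proof.
rewrite innerE; apply: (le_trans (ler_norm_sum _ _ _)).
apply: (@le_trans _ _ (\sum_(i < n) \sum_(j < n) `|M| * (`|u| * `|v|))); last first.
  by rewrite !sumr_const card_ord -mulrnA -natrX mulr_natl mulnn.
apply: ler_sum => i _; apply: (le_trans (ler_norm_sum _ _ _)).
apply: ler_sum => j _; rewrite !normrM mulrAC mulrC; apply: ler_pM => //.
- exact: rV_coord_le.
- by apply: ler_pM => //; exact: rV_coord_le.
Qed.

Lemma cvg_sum_seq (T : Type) (F : set_system T) (FF : Filter F) (I : Type) (r : seq I)
    (f : I -> T -> R) (l : I -> R) :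
  (forall i, f i @ F --> l i) -> (fun t => \sum_(i <- r) f i t) @ F --> \sum_(i <- r) l i.
Proof.
move=> fl; elim: r => [|i r IHr].
  rewrite (_ : (fun t => _) = cst 0); first by rewrite big_nil; exact: cvg_cst.
  by apply/funext => t; rewrite big_nil.
rewrite (_ : (fun t => _) = (fun t => f i t + \sum_(j <- r) f j t)).
  by rewrite big_cons; apply: cvgD; [exact: fl|exact: IHr].
by apply/funext => t; rewrite big_cons.
Qed.

Lemma cvg_prod_seq (T : Type) (F : set_system T) (FF : Filter F) (I : Type) (r : seq I)
    (f : I -> T -> R) (l : I -> R) :
  (forall i, f i @ F --> l i) -> (fun t => \prod_(i <- r) f i t) @ F --> \prod_(i <- r) l i.
Proof.
move=> fl; elim: r => [|i r IHr].
  rewrite (_ : (fun t => _) = cst 1); first by rewrite big_nil; exact: cvg_cst.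
  by apply/funext => t; rewrite big_nil.
rewrite (_ : (fun t => _) = (fun t => f i t * \prod_(j <- r) f j t)).
  by rewrite big_cons; apply: cvgM; [exact: fl|exact: IHr].
by apply/funext => t; rewrite big_cons.
Qed.

Lemma cvg_entry (T : Type) (F : set_system T) (FF : Filter F) p q
    (A : T -> 'M[R]_(p, q)) (A0 : 'M[R]_(p, q)) i j :
  A @ F --> A0 -> (fun t => A t i j) @ F --> A0 i j.
Proof.
move=> cA; have cc := @coord_continuous R p q i j A0.
exact: (@cvg_comp _ _ _ A (fun M : 'M[R]_(p, q) => M i j) _ _ _ cA cc).
Qed.

Lemma cvg_det (T : Type) (F : set_system T) (FF : Filter F) p
    (A : T -> 'M[R]_p) (A0 : 'M[R]_p) :
  A @ F --> A0 -> (fun t => \det (A t)) @ F --> \det A0.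
Proof.
move=> cA; rewrite /determinant; apply: cvg_sum_seq => s.
by apply: cvgM; [exact: cvg_cst|apply: cvg_prod_seq => i; exact: cvg_entry].
Qed.

Lemma cvg_inner (T : Type) (F : set_system T) (FF : Filter F) n (G : T -> 'M[R]_n)
    (X Y : T -> 'rV[R]_n) G0 X0 Y0 :
  G @ F --> G0 -> X @ F --> X0 -> Y @ F --> Y0 ->
  (fun t => inner (G t) (X t) (Y t)) @ F --> inner G0 X0 Y0.
Proof.
move=> cG cX cY.
rewrite innerE (_ : (fun t => _) = (fun t => \sum_i \sum_j X t 0 i * G t i j * Y t 0 j)); last first.
  by apply/funext => t; rewrite innerE.
apply: cvg_sum_seq => i; apply: cvg_sum_seq => j.
by apply: cvgM; [apply: cvgM|]; exact: cvg_entry.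
Qed.

Lemma strict_diff_mx m n p (Q : set 'rV[R]_m) (G : 'rV[R]_m -> 'M[R]_(n, p)) x e :
  open Q -> smooth_on Q G -> Q x -> 0 < e ->
  exists2 d, 0 < d & forall y z, ball x d y -> ball x d z ->
    `|G z - G y - 'D_(z - y) G x| <= e * `|z - y|.
Proof.
move=> opQ sG Qx e0.
have dG y : Q y -> differentiable G y := smooth_on_differentiable _ _ _ _ _ sG.
have dGe i j y : Q y -> differentiable (fun z => G z i j) y.
  move=> Qy; apply: (differentiable_comp (g := fun M : 'M[R]_(n, p) => M i j)) => //.
    exact: dG.
  exact: differentiable_coord.
have nQ : \forall y \near x, Q y by exact: open_nbhs_nbhs.
have DE i j v y : Q y -> ('D_v G y) i j = 'D_v (fun z => G z i j) y.
  by move=> Qy; rewrite derive_mx ?mxE//; exact/diff_derivable/dG.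
have cDe i j k : {for x, continuous (fun y => 'D_(delta_mx 0 k) (fun z => G z i j) y)}.
  have E : {near x, (fun y => ('D_(delta_mx 0 k) G y) i j) =1
      (fun y => 'D_(delta_mx 0 k) (fun z => G z i j) y)}.
    by apply: filterS nQ => y Qy; exact: DE.
  apply: differentiable_continuous; apply: (near_eq_differentiable _ _ _ E).
  apply: (differentiable_comp (f := fun y => 'D_(delta_mx 0 k) G y) (g := fun M : 'M[R]_(n, p) => M i j)).
    exact: (smooth_on_differentiable _ _ _ _ _ (smooth_on_partial _ _ _ _ k sG) Qx).
  exact: differentiable_coord.
pose P (ij : 'I_n * 'I_p) d := forall y z, ball x d y -> ball x d z ->
  `|G z ij.1 ij.2 - G y ij.1 ij.2 - 'D_(z - y) (fun z => G z ij.1 ij.2) x| <= e * `|z - y|.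
have nP ij : \forall d \near 0^'+, P ij d.
  have [d d0 dP] := strict_diff _ Q (fun z => G z ij.1 ij.2) x e opQ Qx
    (dGe ij.1 ij.2) (cDe ij.1 ij.2) e0.
  near=> d1 => y z yd zd; have d1d : d1 <= d by near: d1; exact: nbhs_right_le.
  by apply: dP; [exact: le_ball yd|exact: le_ball zd].
have nPs : \forall d \near 0^'+, forall ij, P ij d.
  exact: (@filter_forall _ _ (fun ij d => P ij d) (0^'+) _ nP).
have [d [Pd d0]] := filter_ex (filterI nPs (nbhs_right_gt 0)).
exists d => // y z yd zd; rewrite [leLHS]mx_normrE.
apply/bigmax_leP; split; first by rewrite mulr_ge0// ltW.
move=> ij _; have := Pd ij y z yd zd; rewrite -DE//.
by rewrite !mxE.
Unshelve. all: by end_near. Qed.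

Lemma derive_norm_le (V W : normedModType R) (f : V -> W) x : differentiable f x ->
  exists2 K, 0 < K & forall v, `|'D_v f x| <= K * `|v|.
Proof.
move=> df; have cd : continuous ('d f x) by move=> y; exact: (diff_continuous df).
have [K K0 hK] := linear_lipschitz cd; exists K => // v; rewrite deriveE//.
Qed.

(** Antiderivative of c0 + c1 t + c2 t^2 that vanishes at 0. *)
Definition cubic (c0 c1 c2 t : R) := c0 * t + c1 / 2 * t ^+ 2 + c2 / 3 * t ^+ 3.

Lemma is_derive_cubic (c0 c1 c2 t : R) :
  is_derive t (1 : R) (cubic c0 c1 c2) (c0 + c1 * t + c2 * t ^+ 2).
Proof.
have h : forall s, cubic c0 c1 c2 s = (c0 *: 'X + (c1 / 2) *: 'X^2 + (c2 / 3) *: 'X^3).[s].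
  by move=> s; rewrite !hornerE /cubic /=; ring.
rewrite (_ : cubic c0 c1 c2 = horner (c0 *: 'X + (c1 / 2) *: 'X^2 + (c2 / 3) *: 'X^3)); last exact/funext.
apply: is_derive_eq.
rewrite !derivD !derivZ derivX !derivXn !hornerE /=.
by field.
Qed.

End estimates.

Section short_curve.
Context {R : realType}.

Lemma cvg_line m (T : topologicalType) (g : 'rV[R]_m -> T) w v :
  {for w, continuous g} -> (fun t : R => g (w + t *: v)) @ (0 : R) --> g w.
Proof.
move=> cg; have cl : (fun t : R => w + t *: v) @ (0 : R) --> w.
  rewrite -[X in _ --> X](addr0 w) -(scale0r v).
  by apply: cvgD; [exact: cvg_cst|apply: cvgZr_tmp; exact: cvg_id].
exact: (@cvg_comp _ _ _ (fun t : R => w + t *: v) g _ _ _ cl cg).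
Qed.

(** Quadratic bound whose leading coefficient is the squared norm of the
derivative, obtained from the difference quotient so that no second derivative of
[Y] enters. *)
Lemma square_estimate k (Y : R -> 'rV[R]_k) yb eta :
  is_derive (0 : R) (1 : R) Y yb -> 0 < eta ->
  \forall t \near (0 : R), inner 1%:M (Y t - Y 0) (Y t - Y 0) <= t ^+ 2 * (inner 1%:M yb yb + eta).
Proof.
move=> [dY <-] eta0.
have cq : (fun h : R => h^-1 *: (Y (h *: (1 : R) + 0) - Y 0)) @ 0^' --> 'D_1 Y 0 by exact: dY.
have ci : (fun h : R => inner 1%:M (h^-1 *: (Y (h *: (1 : R) + 0) - Y 0))
     (h^-1 *: (Y (h *: (1 : R) + 0) - Y 0))) @ 0^' --> inner 1%:M ('D_1 Y 0) ('D_1 Y 0).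
  by apply: cvg_inner => //; exact: cvg_cst.
have n1 : \forall h \near 0^', inner 1%:M (h^-1 *: (Y (h *: (1 : R) + 0) - Y 0))
     (h^-1 *: (Y (h *: (1 : R) + 0) - Y 0)) < inner 1%:M ('D_1 Y 0) ('D_1 Y 0) + eta.
  have hc := (cvgrPdist_lt _ _).1 ci eta eta0.
  near=> h.
  have : `|inner 1%:M ('D_1 Y 0) ('D_1 Y 0) - inner 1%:M (h^-1 *: (Y (h *: (1 : R) + 0) - Y 0))
     (h^-1 *: (Y (h *: (1 : R) + 0) - Y 0))| < eta by near: h; exact: hc.
  by rewrite distrC => /(le_lt_trans (ler_norm _)); rewrite ltrBlDl.
have {n1} := n1; rewrite near_withinE => n1.
near=> t; have [->|t0] := eqVneq t 0.
  by rewrite subrr expr0n/= mul0r /inner !mul0mx mxE.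
have : t != 0 -> inner 1%:M (t^-1 *: (Y (t *: (1 : R) + 0) - Y 0))
     (t^-1 *: (Y (t *: (1 : R) + 0) - Y 0)) < inner 1%:M ('D_1 Y 0) ('D_1 Y 0) + eta.
  by near: t.
move=> /(_ t0); rewrite innerZl innerZr addr0 /GRing.scale/= mulr1 mulrA -expr2 exprVn => h.
have t20 : 0 < t ^+ 2 by rewrite exprn_even_gt0.
by rewrite -ler_pdivrMl//; exact: ltW.
Unshelve. all: by end_near. Qed.

(** Collects the expansions of the three parts of the integrand into a quadratic
polynomial in the time [s]. Here [A] stands for |y' - e|^2, [T1] for the increment of
the metric between the two curves evaluated on sigma', and [Bf], [Cc] for <x', z> and
|z|^2 along [x]. *)
Lemma deficit_le (A T1 Bf Cc beta kappa D Zz Yb eta t s : R) :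
  A <= s ^+ 2 * (Yb + eta) -> T1 <= (t ^+ 2 - s ^+ 2) / 2 * D + eta * t ^+ 2 ->
  `|Bf - beta - s * kappa| <= eta * `|s| -> Cc <= Zz + eta ->
  2^-1 * (A + T1 - 2 * s * Bf + s ^+ 2 * Cc) <=
    2^-1 * (D * t ^+ 2 / 2 + eta * t ^+ 2) + - beta * s +
    2^-1 * (Yb + Zz + 4 * eta - 2 * kappa - D / 2) * s ^+ 2.
Proof.
move=> hA hT hB hC.
have h1 : - (s * Bf) <= - (beta * s) - kappa * s ^+ 2 + eta * s ^+ 2.
  have : `|s * (Bf - beta - s * kappa)| <= eta * s ^+ 2.
    rewrite normrM -real_normK ?num_real// expr2 mulrCA.
    by apply: ler_wpM2l.
  rewrite ler_norml => /andP[h _]; move: h.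
  rewrite !mulrBr expr2 => h; lra.
have h2 : s ^+ 2 * Cc <= s ^+ 2 * (Zz + eta) by rewrite ler_wpM2l// sqr_ge0.
lra.
Qed.

(** Increment of the metric from a point [p] of the hypersurface to the point [p'] of
the translated shortcut, displaced by [q z + a]. *)
Lemma metric_increment n (G : 'rV[R]_n -> 'M[R]_n) x0 p p' z a (q K C eps eta t D : R) s :
  differentiable G x0 -> 0 <= q <= t ^+ 2 / 2 -> p' - p = q *: z + a ->
  0 <= eps -> 0 <= K ->
  `|G p' - G p - 'D_(p' - p) G x0| <= eps * `|p' - p| ->
  `|'D_a G x0| <= K * `|a| -> `|s| <= C ->
  `|inner ('D_z G x0) s s - D| <= eta ->
  n%:R ^+ 2 * ((eps * (q * `|z| + `|a|) + K * `|a|) * (C * C)) <= eta * t ^+ 2 / 2 ->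
  inner (G p' - G p) s s <= q * D + eta * t ^+ 2.
Proof.
move=> dG /andP[q0 qt] pp eps0 K0 hM ha hs hD hC.
rewrite pp in hM.
set M := G p' - G p - _ in hM.
have nqz : `|q *: z + a| <= q * `|z| + `|a|.
  by apply: (le_trans (ler_normD _ _)); rewrite normrZ ger0_norm.
have E : G p' - G p = (M + 'D_a G x0) + q *: 'D_z G x0.
  by rewrite /M deriveD_dir// deriveZ_dir// opprD addrA !subrK.
have h1 : inner (M + 'D_a G x0) s s <= eta * t ^+ 2 / 2.
  apply: (le_trans (ler_norm _)); apply: (le_trans (inner_le _ _ _ _)); apply: le_trans hC.
  apply: ler_wpM2l; first exact: exprn_ge0.
  apply: ler_pM => //.
    apply: (le_trans (ler_normD _ _)); apply: lerD => //.
    by apply: (le_trans hM); apply: ler_wpM2l.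
  exact: ler_pM.
have h2 : q * inner ('D_z G x0) s s <= q * D + eta * t ^+ 2 / 2.
  have eta0 : 0 <= eta by exact: le_trans hD.
  have h3 : inner ('D_z G x0) s s <= D + eta.
    by move: (le_trans (ler_norm _) hD); rewrite lerBlDl.
  apply: (le_trans (ler_wpM2l q0 h3)); rewrite mulrDr lerD2l.
  by rewrite -mulrA mulrC; apply: ler_wpM2l.
rewrite E inner_mxD inner_mxZ.
move: h1 h2; move: (inner _ _ _) (q * _) (q * D) => a1 a2 a3 h1 h2.
by rewrite [eta * _]splitr; lra.
Qed.

(** Cauchy-Schwarz without square roots: |d| <= (1 + |d|^2) / 2, with an error
quadratic in |d| - 1. *)
Lemma unit_inner_le k (e d : 'rV[R]_k) : inner 1%:M e e = 1 ->
  inner 1%:M e d <= 2^-1 * (1 + inner 1%:M d d).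
Proof.
move=> e1; have := inner1_ge0 k (e - d).
rewrite innerBl !innerBr e1 (innerC _ _ d e) ?trmx1//.
lra.
Qed.

Lemma unit_inner_eq k (e d : 'rV[R]_k) : inner 1%:M e e = 1 ->
  inner 1%:M e d = 2^-1 * (1 + inner 1%:M d d - inner 1%:M (d - e) (d - e)).
Proof.
move=> e1; rewrite [inner _ (d - e) _]innerBl !innerBr e1 (innerC _ _ d e) ?trmx1//.
by field.
Qed.

Lemma inner_sub_line n (G : 'M[R]_n) X z s : G^T = G ->
  inner G (X - s *: z) (X - s *: z) =
  inner G X X - 2 * s * inner G X z + s ^+ 2 * inner G z z.
Proof.
move=> Gs; rewrite innerBl !innerBr !innerZl !innerZr (innerC _ _ z X)//.
by ring.
Qed.

End short_curve.

Section obstruction.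
Context {R : realType}.

(** The estimates that hold for all times [t] near 0, gathered so that a single
radius serves for all of them. The number [kappa] is the derivative at 0 of
<x', z>. *)
Lemma local_estimates n m (Q : set 'rV[R]_m) (F y : 'rV[R]_m -> 'rV[R]_n)
    (P : set 'rV[R]_n) (G : 'rV[R]_n -> 'M[R]_n) (w v : 'rV[R]_m) (z : 'rV[R]_n)
    (kappa eta d : R) :
  open Q -> smooth_on Q F -> smooth_on Q y -> Q w ->
  open P -> smooth_on P G -> P (F w) ->
  kappa = inner ('D_('D_v F w) G (F w)) ('D_v F w) z
    + inner (G (F w)) ('D_v (fun x => 'D_v F x) w) z ->
  0 < eta -> 0 < d ->
  exists2 delta, 0 < delta & forall t : R, `|t| < delta ->
    [/\ Q (w + t *: v), P (F (w + t *: v)) & ball (F w) d (F (w + t *: v))] /\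
    [/\ inner 1%:M ('D_v y (w + t *: v) - 'D_v y w) ('D_v y (w + t *: v) - 'D_v y w)
          <= t ^+ 2 * (inner 1%:M ('D_v (fun x => 'D_v y x) w) ('D_v (fun x => 'D_v y x) w) + eta),
        `|inner (G (F (w + t *: v))) ('D_v F (w + t *: v)) z
            - inner (G (F w)) ('D_v F w) z - t * kappa| <= eta * `|t|,
        inner (G (F (w + t *: v))) z z <= inner (G (F w)) z z + eta &
        `|inner ('D_z G (F w)) ('D_v F (w + t *: v) - t *: z) ('D_v F (w + t *: v) - t *: z)
           - inner ('D_z G (F w)) ('D_v F w) ('D_v F w)| <= eta] /\
    (`|'D_v F (w + t *: v) - t *: z| <= `|'D_v F w| + 1 /\
    `|'D_v y (w + t *: v)| <= `|'D_v y w| + 1).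
Proof.
move=> opQ sF sy Qw opP sG Pw kE eta0 d0.
have dF : differentiable F w := smooth_on_differentiable _ _ _ _ _ sF Qw.
have dG : differentiable G (F w) := smooth_on_differentiable _ _ _ _ _ sG Pw.
have dDF : differentiable (fun x => 'D_v F x) w := smooth_on_derive _ _ _ _ v _ opQ sF Qw.
have dDy : differentiable (fun x => 'D_v y x) w := smooth_on_derive _ _ _ _ v _ opQ sy Qw.
have w0 : w + (0 : R) *: v = w by rewrite scale0r addr0.
have cF : (fun t : R => F (w + t *: v)) @ (0 : R) --> F w.
  exact: cvg_line (differentiable_continuous dF).
have cG : (fun t : R => G (F (w + t *: v))) @ (0 : R) --> G (F w).
  apply: (cvg_line _ _ (G \o F)); apply: differentiable_continuous.
  exact: differentiable_comp.
have cX : (fun t : R => 'D_v F (w + t *: v)) @ (0 : R) --> 'D_v F w.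
  exact: (cvg_line _ _ (fun x => 'D_v F x)  _ _ (differentiable_continuous dDF)).
have cY : (fun t : R => 'D_v y (w + t *: v)) @ (0 : R) --> 'D_v y w.
  exact: (cvg_line _ _ (fun x => 'D_v y x)  _ _ (differentiable_continuous dDy)).
have cS : (fun t : R => 'D_v F (w + t *: v) - t *: z) @ (0 : R) --> 'D_v F w.
  rewrite -[X in _ --> X](subr0 ('D_v F w)) -(scale0r z).
  by apply: cvgB; [exact: cX|apply: cvgZr_tmp; exact: cvg_id].
have n1 : \forall t \near (0 : R), Q (w + t *: v).
  have : (fun t : R => w + t *: v) @ (0 : R) --> w.
    exact: (cvg_line _ _ (fun x : 'rV[R]_m => x) w v (fun A => id)).
  by apply; apply: open_nbhs_nbhs.
have n2 : \forall t \near (0 : R), P (F (w + t *: v)).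
  by apply: cF; apply: open_nbhs_nbhs.
have n3 : \forall t \near (0 : R), ball (F w) d (F (w + t *: v)).
  by apply: cF; exact: nbhsx_ballx.
have n4 : \forall t \near (0 : R),
    inner 1%:M ('D_v y (w + t *: v) - 'D_v y w) ('D_v y (w + t *: v) - 'D_v y w)
      <= t ^+ 2 * (inner 1%:M ('D_v (fun x => 'D_v y x) w) ('D_v (fun x => 'D_v y x) w) + eta).
  have h : is_derive (0 : R) (1 : R) (fun t : R => 'D_v y (w + t *: v)) ('D_v (fun x => 'D_v y x) w).
    have := is_derive_line (fun x => 'D_v y x) w v 0; rewrite w0; apply.
    exact: diff_derivable.
  by have := square_estimate _ _ _ _ h eta0; rewrite w0.
have n5 : \forall t \near (0 : R), `|inner (G (F (w + t *: v))) ('D_v F (w + t *: v)) z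
            - inner (G (F w)) ('D_v F w) z - t * kappa| <= eta * `|t|.
  have hF : is_derive w v F ('D_v F w) by exact/derivableP/diff_derivable.
  have hG : is_derive w v (fun y => G (F y)) ('D_('D_v F w) G (F w)).
    exact: (is_derive_comp_diff _ _ _ _ F G w v _ hF dF dG).
  have hX : is_derive w v (fun x => 'D_v F x) ('D_v (fun x => 'D_v F x) w).
    exact/derivableP/diff_derivable.
  have hz := is_derive_cst z w v.
  have [h1 h2] := is_derive_inner _ _ _ _ _ _ _ _ _ hG hX hz.
  have h3 : 'D_v (fun x => inner (G (F x)) ('D_v F x) z) w = kappa.
    apply: (etrans h2); rewrite kE -[RHS]addr0; congr (_ + _).
    by rewrite /inner trmx0 mulmx0 mxE.
  have h4 : is_derive (0 : R) (1 : R)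
      (fun t : R => inner (G (F (w + t *: v))) ('D_v F (w + t *: v)) z) kappa.
    have := is_derive_line (fun x => inner (G (F x)) ('D_v F x) z) w v 0.
    by rewrite w0 => /(_ h1); rewrite h3.
  have := is_derive1_eps _ _ _ _ _ h4 eta0.
  by rewrite w0; apply: filterS => t; rewrite !subr0.
have n6 : \forall t \near (0 : R), inner (G (F (w + t *: v))) z z <= inner (G (F w)) z z + eta.
  have c : (fun t : R => inner (G (F (w + t *: v))) z z) @ (0 : R) --> inner (G (F w)) z z.
    by apply: cvg_inner => //; exact: cvg_cst.
  have hc := (cvgrPdist_le _ _).1 c eta eta0.
  near=> t; have : `|inner (G (F w)) z z - inner (G (F (w + t *: v))) z z| <= eta.
    by near: t; exact: hc.
  by rewrite distrC => /(le_trans (ler_norm _)); rewrite lerBlDl.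
have n7 : \forall t \near (0 : R),
   `|inner ('D_z G (F w)) ('D_v F (w + t *: v) - t *: z) ('D_v F (w + t *: v) - t *: z)
           - inner ('D_z G (F w)) ('D_v F w) ('D_v F w)| <= eta.
  have c : (fun t : R => inner ('D_z G (F w)) ('D_v F (w + t *: v) - t *: z)
      ('D_v F (w + t *: v) - t *: z)) @ (0 : R) --> inner ('D_z G (F w)) ('D_v F w) ('D_v F w).
    by apply: cvg_inner => //; exact: cvg_cst.
  have hc := (cvgrPdist_le _ _).1 c eta eta0.
  near=> t; rewrite distrC; near: t; exact: hc.
have nrm (k : nat) (f : R -> 'rV[R]_k) f0 : f @ (0 : R) --> f0 -> \forall t \near (0 : R), `|f t| <= `|f0| + 1.
  move=> cf; have hc := (cvgrPdist_le _ _).1 cf 1 ltr01.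
  near=> t; have h : `|f0 - f t| <= 1 by near: t; exact: hc.
  rewrite -[f t](subKr f0); apply: (le_trans (ler_normB _ _)); exact: lerD.
have n8 := nrm _ _ _ cS.
have n9 := nrm _ _ _ cY.
have [delta /= delta0 dP] := (nbhs_ballP _ _).1 (filterI n1 (filterI n2 (filterI n3
  (filterI n4 (filterI n5 (filterI n6 (filterI n7 (filterI n8 n9)))))))).
exists delta => // t td; have bt : ball (0 : R) delta t.
  by rewrite -ball_normE/= sub0r normrN.
have [h1 [h2 [h3 [h4 [h5 [h6 [h7 [h8 h9]]]]]]]] := dP t bt.
by split; [split|split; split].
Unshelve. all: by end_near. Qed.


Lemma clamp_itv (t s : R) : 0 <= t -> - t <= Num.max (- t) (Num.min s t) <= t.
Proof.
move=> t0; rewrite le_max lexx/= ge_max ge_min lexx orbT andbT.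
by rewrite (le_trans _ t0)// oppr_le0.
Qed.

Lemma clamp_id (t s : R) : - t <= s <= t -> Num.max (- t) (Num.min s t) = s.
Proof. by move=> /andP[h1 h2]; rewrite min_l// max_r. Qed.

(** A curve that is continuous on an interval only is extended to the line by
freezing it at the endpoints. *)
Lemma clamp_continuous (T : topologicalType) (t : R) (f : R -> T) : 0 <= t ->
  (forall s, - t <= s <= t -> {for s, continuous f}) ->
  continuous (fun s => f (Num.max (- t) (Num.min s t))).
Proof.
move=> t0 cf s.
have cc : {for s, continuous (fun s : R => Num.max (- t) (Num.min s t))}.
  apply: (@continuous_max _ _ (fun=> - t) (fun s => Num.min s t)).
    exact: cvg_cst.
  apply: (@continuous_min _ _ (fun s => s) (fun=> t)); first exact: cvg_id.
  exact: cvg_cst.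
exact: (@continuous_comp _ _ _ (fun s : R => Num.max (- t) (Num.min s t)) f s cc
  (cf _ (clamp_itv t s t0))).
Qed.

End obstruction.

(** * The obstruction in coordinates *)

Section obstruction_main.
Context {R : realType}.

(** The derivative of <e, u(sigma) - y> minus the quadratic polynomial is not
positive: [I1] and [I2] are the inner products of [e] with the velocities of
u(sigma) and of [y]. *)
Lemma deficit_nonpos (I1 I2 S' YY A XX T1 B Cc s p : R) :
  I1 <= 2^-1 * (1 + S') -> I2 = 2^-1 * (1 + YY - A) -> YY = XX ->
  S' = T1 + (XX - 2 * s * B + s ^+ 2 * Cc) ->
  2^-1 * (A + T1 - 2 * s * B + s ^+ 2 * Cc) <= p -> I1 + (- I2 - p) <= 0.
Proof. by move=> h1 -> -> hS hp; rewrite hS in h1; lra. Qed.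

(** The quadratic polynomial is integrated from -t to t: its linear part cancels,
and by the relation between [kappa] and [Zz] the derivative [D] of the metric cancels
too. [E1] and [E2] are the values of <e, u> at the two ends of the translated
shortcut, which are close to those of <e, y>. *)
Lemma deficit_integral (E1 E2 y1 y2 beta kappa D Zz Yb eta t c0 c2 : R) :
  0 < t -> kappa = Zz + D / 2 ->
  c0 = 2^-1 * (D * t ^+ 2 / 2 + eta * t ^+ 2) ->
  c2 = 2^-1 * (Yb + Zz + 4 * eta - 2 * kappa - D / 2) ->
  `|E1 - y1| <= eta * t ^+ 3 / 2 -> `|E2 - y2| <= eta * t ^+ 3 / 2 ->
  E1 + (- y1 - cubic c0 (- beta) c2 t) <= E2 + (- y2 - cubic c0 (- beta) c2 (- t)) ->
  Zz <= Yb + eta * 10.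
Proof.
move=> t0 -> -> ->; rewrite !ler_norml => /andP[h1 _] /andP[_ h2].
rewrite /cubic => h3.
have t30 : 0 < t ^+ 3 by rewrite exprn_gt0.
rewrite -subr_ge0 -(pmulr_rge0 _ t30).
lra.
Qed.

(** The choices of the precision of the metric expansion and of the size of the
translation make the error in [metric_increment] at most half of eta t^2. *)
Lemma increment_budget (N2 C q nz na K eta t : R) :
  0 <= q <= t ^+ 2 / 2 -> 0 <= N2 -> 0 <= nz -> 0 < eta -> 0 < K ->
  na <= t ^+ 2 -> na <= eta * t ^+ 2 / (4 * (N2 * (C * C) + 1) * (K + 1)) ->
  N2 * ((eta / (4 * (N2 * (C * C) + 1) * (nz + 1)) * (q * nz + na) + K * na) * (C * C))
    <= eta * t ^+ 2 / 2.
Proof.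
move=> /andP[q0 qt] N20 nz0 eta0 K0 na1 na2.
have CC0 : 0 <= C * C by rewrite -expr2 sqr_ge0.
have [N1 N1E] : exists N1, N1 = N2 * (C * C) + 1 by exists (N2 * (C * C) + 1).
rewrite -N1E in na2 *.
have N10 : 0 < N1 by rewrite N1E ltr_wpDl// mulr_ge0.
have K10 : 0 < K + 1 by rewrite addr_gt0.
have Nz0 : 0 < nz + 1 by rewrite ltr_wpDl.
have D1 : 0 < 4 * N1 * (nz + 1) by apply: mulr_gt0 => //; apply: mulr_gt0.
have D2 : 0 < 4 * N1 * (K + 1) by apply: mulr_gt0 => //; apply: mulr_gt0.
have D3 : 0 < 4 * N1 by apply: mulr_gt0.
have et0 : 0 <= eta * t ^+ 2 by apply: mulr_ge0; [exact: ltW|exact: sqr_ge0].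
have h1 : q * nz + na <= t ^+ 2 * (nz + 1).
  rewrite mulrDr mulr1; apply: lerD => //; apply: ler_wpM2r => //.
  by apply: (le_trans qt); rewrite ler_piMr ?sqr_ge0// invf_le1// ler1n.
have h2 : eta / (4 * N1 * (nz + 1)) * (q * nz + na) <= eta * t ^+ 2 / (4 * N1).
  apply: (@le_trans _ _ (eta / (4 * N1 * (nz + 1)) * (t ^+ 2 * (nz + 1)))).
    by apply: ler_wpM2l => //; apply: divr_ge0; exact: ltW.
  by rewrite le_eqVlt; apply/orP; left; apply/eqP; field; rewrite ?gt_eqF.
have h3 : K * na <= eta * t ^+ 2 / (4 * N1).
  apply: (@le_trans _ _ (K * (eta * t ^+ 2 / (4 * N1 * (K + 1))))).
    by apply: ler_wpM2l => //; exact: ltW.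
  apply: (@le_trans _ _ ((K + 1) * (eta * t ^+ 2 / (4 * N1 * (K + 1))))).
    apply: ler_wpM2r; last by rewrite lerDl.
    by apply: divr_ge0 => //; exact: ltW.
  by rewrite le_eqVlt; apply/orP; left; apply/eqP; field; rewrite ?gt_eqF.
rewrite [leRHS](_ : _ = N1 * (eta * t ^+ 2 / (4 * N1) + eta * t ^+ 2 / (4 * N1))); last first.
  by field; rewrite gt_eqF.
apply: (@le_trans _ _ (N2 * (C * C) * (eta * t ^+ 2 / (4 * N1) + eta * t ^+ 2 / (4 * N1)))).
  rewrite -[leRHS]mulrA [C * C * _]mulrC; apply: ler_wpM2l => //.
  by apply: ler_wpM2r => //; exact: lerD.
apply: ler_wpM2r; last by rewrite N1E lerDl.
by apply: addr_ge0; apply: divr_ge0 => //; exact: ltW.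
Qed.

Lemma half_gap (t s : R) : - t <= s <= t -> 0 <= (t ^+ 2 - s ^+ 2) / 2 <= t ^+ 2 / 2.
Proof.
rewrite -ler_norml => st; have : s ^+ 2 <= t ^+ 2.
  by rewrite -(real_normK (num_real s)) lerXn2r ?nnegrE// (le_trans _ st).
by have := sqr_ge0 s; move=> h1 h2; apply/andP; split; lra.
Qed.

Lemma quadratic_le (c0 beta c2 s t : R) : t <= 1 -> - t <= s <= t ->
  - (c0 + - beta * s + c2 * s ^+ 2) <= `|c0| + `|beta| + `|c2|.
Proof.
move=> t1; rewrite -ler_norml => st; have s1 := le_trans st t1.
apply: (le_trans (ler_norm _)); rewrite normrN.
apply: (le_trans (ler_normD _ _)); apply: lerD.
  apply: (le_trans (ler_normD _ _)); apply: lerD => //.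
  by rewrite normrM normrN ler_piMr.
by rewrite normrM normrX ler_piMr// exprn_ile1.
Qed.

(** The comparison of the shortcut with the chord, in a chart. The last hypothesis
is the form in which isometry almost everywhere can be used along curves. *)
Lemma coordinate_obstruction n m (Q : set 'rV[R]_m) (F y : 'rV[R]_m -> 'rV[R]_n)
    (P : set 'rV[R]_n) (G : 'rV[R]_n -> 'M[R]_n) (w v : 'rV[R]_m)
    (u : 'rV[R]_n -> 'rV[R]_n) (r L : R) :
  open Q -> smooth_on Q F -> smooth_on Q y -> Q w ->
  open P -> smooth_on P G -> P (F w) -> (forall x, P x -> (G x)^T = G x) ->
  G (F w) \in unitmx ->
  (forall w', Q w' -> pullback (@flat R n) y w' = pullback G F w') ->
  inner 1%:M ('D_v y w) ('D_v y w) = 1 ->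
  0 < r -> 0 <= L ->
  (forall x x', ball (F w) r x -> ball (F w) r x' -> `|u x - u x'| <= L * `|x - x'|) ->
  (forall w', Q w' -> ball (F w) r (F w') -> u (F w') = y w') ->
  (forall (sigma : R -> 'rV[R]_n) rho, continuous sigma -> 0 < rho ->
    exists2 a : 'rV[R]_n, `|a| < rho & (@lebesgue_measure R).-negligible
      [set t | ball (F w) r (sigma t + a) /\
        ~ exists2 D, is_diff_within setT u (sigma t + a) D & D *m D^T = G (sigma t + a)]) ->
  inner (G (F w)) (nabla G F w v v) (nabla G F w v v) <=
  inner 1%:M ('D_v (fun x => 'D_v y x) w) ('D_v (fun x => 'D_v y x) w).
Proof.
move=> opQ sF sy Qw opP sG Pw Gs uG iso e1 r0 L0 uL uy null.
have dFw : differentiable F w := smooth_on_differentiable _ _ _ _ _ sF Qw.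
have dG : differentiable G (F w) := smooth_on_differentiable _ _ _ _ _ sG Pw.
set z := nabla G F w v v; set yb := 'D_v (fun x => 'D_v y x) w.
set x0 := F w in dG uL uy null Gs uG Pw *; set X0 := 'D_v F w.
set e := 'D_v y w in e1 *.
pose Zz := inner (G x0) z z; pose D := inner ('D_z G x0) X0 X0.
pose kappa := inner ('D_X0 G x0) X0 z + inner (G x0) ('D_v (fun x => 'D_v F x) w) z.
have kE : kappa = Zz + D / 2.
  (* z is x'' plus the Christoffel term, whose inner product with z is known. *)
  have h1 : inner (G x0) z z = inner (G x0) ('D_v (fun x => 'D_v F x) w) z
      + (inner ('D_X0 G x0) X0 z - 2^-1 * D).
    rewrite {2}/z /nabla innerDl; congr (_ + _).
    exact: (inner_christoffel _ G x0 X0 z dG (Gs _ Pw) uG).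
  by rewrite /kappa /Zz h1; field.
apply/ler_addgt0Pr => eta' eta'0.
(* The errors of the final estimate add up to 10 eta. *)
pose eta := eta' / 10; have eta0 : 0 < eta by rewrite divr_gt0.
have [K K0 hK] := derive_norm_le _ _ _ _ dG.
pose C := `|X0| + 1; pose N1 := n%:R ^+ 2 * (C * C) + 1.
have C0 : 0 < C by rewrite ltr_wpDl.
have N10 : 0 < N1 by rewrite ltr_wpDl// mulr_ge0 ?exprn_ge0// mulr_ge0// ltW.
pose Nz := `|z| + 1; have Nz0 : 0 < Nz by rewrite ltr_wpDl.
pose eps := eta / (4 * N1 * Nz).
have eps0 : 0 < eps by rewrite divr_gt0// !mulr_gt0.
have [d1 d10 hstrict] := strict_diff_mx _ _ _ P G x0 eps opP sG Pw eps0.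
(* A third of the radius for each of the displacements from x0: to the curve, by the multiple of z, by a. *)
pose d := Num.min d1 r / 3.
have m0 : 0 < Num.min d1 r by rewrite lt_min d10.
have d0 : 0 < d by rewrite divr_gt0.
have [delta delta0 est] := local_estimates _ _ Q F y P G w v z kappa eta d
  opQ sF sy Qw opP sG Pw erefl eta0 d0.
pose t := Num.min 1 (Num.min (delta / 2) (d / Nz)).
have t0 : 0 < t by rewrite !lt_min ltr01 !divr_gt0.
have t1 : t <= 1 by rewrite ge_min lexx.
have td : t < delta.
  have : t <= delta / 2 by rewrite !ge_min lexx !orbT.
  by move=> /le_lt_trans; apply; rewrite ltr_pdivrMr// mulr_natr mulr2n ltrDl.
have tNz : t * Nz <= d by rewrite -ler_pdivlMr// !ge_min lexx !orbT.
clearbody t.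
have t20 : 0 < t ^+ 2 by rewrite exprn_gt0.
have t30 : 0 < t ^+ 3 by rewrite exprn_gt0.
pose M1 := n%:R * (`|e| * L) + 1.
have M10 : 0 < M1 by rewrite ltr_wpDl// !mulr_ge0.
(* The translation is small against t^2 for the increment of the metric, and against t^3 for the values of u at the two ends. *)
pose rho := Num.min (Num.min (t ^+ 2) d)
  (Num.min (eta * t ^+ 2 / (4 * N1 * (K + 1))) (eta * t ^+ 3 / (2 * M1))).
have K10 : 0 < K + 1 by rewrite addr_gt0.
have rho0 : 0 < rho by rewrite !lt_min t20 d0/= !divr_gt0// !mulr_gt0.
pose sigma (s : R) := F (w + s *: v) + ((t ^+ 2 - s ^+ 2) / 2) *: z.
pose dsigma (s : R) := 'D_v F (w + s *: v) - s *: z.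
have itvP s : - t <= s <= t -> `|s| < delta.
  by rewrite -ler_norml => /le_lt_trans; apply.
have dF' s : Q (w + s *: v) -> differentiable F (w + s *: v).
  exact: smooth_on_differentiable sF.
have dy' s : Q (w + s *: v) -> differentiable y (w + s *: v).
  exact: smooth_on_differentiable sy.
have hsigma s : - t <= s <= t -> is_derive s (1 : R) sigma (dsigma s).
  move=> hs; have [[Qs _ _] _] := est s (itvP s hs).
  have h1 : is_derive s (1 : R) (fun s : R => F (w + s *: v)) ('D_v F (w + s *: v)).
    by apply: is_derive_line; apply: diff_derivable; exact: dF'.
  have h2 : is_derive s (1 : R) (fun s : R => ((t ^+ 2 - s ^+ 2) / 2) *: z) (- s *: z).
    apply/is_derive_mxP => i j.
    rewrite (_ : (fun s => _) = (fun s => cubic 0 (- z i j) 0 s + t ^+ 2 / 2 * z i j)).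
      rewrite (_ : (- s *: z) i j = 0 + - z i j * s + 0 * s ^+ 2 + 0); last by rewrite mxE; ring.
      exact: is_deriveD (is_derive_cubic 0 (- z i j) 0 s) (is_derive_cst (t ^+ 2 / 2 * z i j) s (1 : R)).
    by apply/funext => s'; rewrite mxE /cubic; field.
  by rewrite /dsigma -scaleNr; exact: is_deriveD h1 h2.
(* The clamped curve agrees with sigma on [-t, t]. *)
have [a arho negN] := null _ rho (clamp_continuous _ t sigma (ltW t0)
  (fun s hs => is_derive1_continuous _ _ _ _ (hsigma s hs))) rho0.
set N := [set s | _] in negN.
have [at2 [ad [aK aL]]] : `|a| <= t ^+ 2 /\ `|a| <= d /\
    `|a| <= eta * t ^+ 2 / (4 * N1 * (K + 1)) /\ `|a| <= eta * t ^+ 3 / (2 * M1).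
  by move: arho; rewrite !lt_min => /andP[/andP[h1 h2] /andP[h3 h4]]; rewrite !ltW.
have qP s : - t <= s <= t -> 0 <= (t ^+ 2 - s ^+ 2) / 2 <= t ^+ 2 / 2.
  by move=> hs; apply: half_gap.
have qz s : - t <= s <= t -> `|((t ^+ 2 - s ^+ 2) / 2) *: z| <= d.
  move=> hs; have /andP[q0 q1] := qP s hs; rewrite normrZ ger0_norm//.
  apply: le_trans tNz; apply: ler_pM => //; last by rewrite lerDl.
  apply: (le_trans q1); rewrite ler_pdivrMr// expr2 ler_pM2l//.
  by rewrite (le_trans t1)// ler1n.
have three_d : 3 * d = Num.min d1 r by rewrite /d mulrC divfK.
have inball s : - t <= s <= t ->
    ball x0 (Num.min d1 r) (F (w + s *: v)) /\ ball x0 (Num.min d1 r) (sigma s + a).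
  move=> hs; have [[_ _ bF] _] := est s (itvP s hs); split.
    by apply: le_ball bF; rewrite -three_d; apply: ler_peMl; [exact: ltW|rewrite ler1n].
  rewrite -three_d -ball_normE/=; rewrite -ball_normE/= in bF.
  rewrite /sigma !opprD !addrA; apply: (le_lt_trans (ler_normB _ _)).
  rewrite (_ : 3 * d = (d + d) + d); last by ring.
  apply: ltr_leD => //; apply: (le_lt_trans (ler_normB _ _)).
  by apply: ltr_leD => //; exact: qz.
pose c0 := 2^-1 * (D * t ^+ 2 / 2 + eta * t ^+ 2).
pose beta := inner (G x0) X0 z.
pose c2 := 2^-1 * (inner 1%:M yb yb + Zz + 4 * eta - 2 * kappa - D / 2).
pose g s := - inner 1%:M e (y (w + s *: v)) - cubic c0 (- beta) c2 s.
pose dg s := - inner 1%:M e ('D_v y (w + s *: v)) - (c0 + - beta * s + c2 * s ^+ 2).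
pose C2 := C + (n%:R * (`|e| * (`|e| + 1)) + (`|c0| + `|beta| + `|c2|)).
have C20 : 0 <= C2 by rewrite !addr_ge0 ?mulr_ge0 ?addr_ge0// ltW.
have hg s : - t <= s <= t -> is_derive s (1 : R) g (dg s).
  move=> hs; have [[Qs _ _] _] := est s (itvP s hs).
  have h1 : is_derive s (1 : R) (fun s : R => y (w + s *: v)) ('D_v y (w + s *: v)).
    by apply: is_derive_line; apply: diff_derivable; exact: dy'.
  exact: is_deriveB (is_deriveN (is_derive_inner1 _ _ e _ _ h1)) (is_derive_cubic c0 (- beta) c2 s).
have hgam s : - t <= s <= t -> is_derive s (1 : R) (fun s => sigma s + a) (dsigma s).
  move=> hs; rewrite -[dsigma s]addr0.
  exact: is_deriveD (hsigma s hs) (is_derive_cst a s (1 : R)).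
have tt : - t <= t by apply: (le_trans _ (ltW t0)); rewrite oppr_le0 ltW.
have key := curve_comparison n n u (fun s => sigma s + a) dsigma e g dg (- t) t C2 L N
  (ball x0 r) tt L0 C20 hgam.
have final : inner 1%:M e (u (sigma t + a)) + g t <= inner 1%:M e (u (sigma (- t) + a)) + g (- t).
  apply: key => //.
  - move=> s hs; have [_ [_ [h _]]] := est s (itvP s hs).
    by apply: (le_trans h); rewrite /C2 lerDl !addr_ge0// ?mulr_ge0// addr_ge0.
  - move=> s hs; have [_ [_ [_ h]]] := est s (itvP s hs).
    have h1 : - inner 1%:M e ('D_v y (w + s *: v)) <= n%:R * (`|e| * (`|e| + 1)).
      apply: (le_trans (ler_norm _)); rewrite normrN; apply: (le_trans (inner1_le _ _ _)).
      by apply: ler_wpM2l => //; apply: ler_wpM2l => //; exact: h.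
    have h2 := quadratic_le c0 beta c2 s t t1 hs.
    by apply: (le_trans (lerD h1 h2)); rewrite /C2 lerDr ltW.
  - exact: ball_open.
  - move=> s hs; have [_] := inball s hs; apply: le_ball.
    by rewrite ge_min lexx orbT.
  - move=> s hs Ns.
    have [_ bs] := inball s hs; have [bF _] := inball s hs.
    have brs : ball x0 r (sigma s + a) by apply: le_ball bs; rewrite ge_min lexx orbT.
    have [D' uD' DD'] : exists2 D', is_diff_within setT u (sigma s + a) D' &
        D' *m D'^T = G (sigma s + a).
      by apply: contrapT => h; apply: Ns; rewrite /N/= clamp_id.
    exists D' => //.
    have [[Qs Ps _] [[eA eB eC eH] [eS _]]] := est s (itvP s hs).
    have T1 : inner (G (sigma s + a) - G (F (w + s *: v))) (dsigma s) (dsigma s)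
        <= (t ^+ 2 - s ^+ 2) / 2 * D + eta * t ^+ 2.
      apply: (metric_increment n G x0 _ _ z a _ K C eps) => //.
      - exact: qP.
      - by rewrite /sigma -[X in X - _]addrA [LHS]addrAC subrr add0r.
      - exact: ltW.
      - exact: ltW.
      - by apply: hstrict; [apply: le_ball bF|apply: le_ball bs]; rewrite ge_min lexx.
      - exact: (increment_budget (n%:R ^+ 2) C _ `|z| `|a| K eta t (qP s hs)
          (exprn_ge0 _ (ler0n _ _)) (normr_ge0 z) eta0 K0 at2 aK).
    have L1 := deficit_le _ _ _ _ _ _ _ _ _ _ _ _ eA T1 eB eC.
    have I1 := unit_inner_le _ _ (dsigma s *m D') e1.
    have I2 := unit_inner_eq _ _ ('D_v y (w + s *: v)) e1.
    have E1 : inner 1%:M ('D_v y (w + s *: v)) ('D_v y (w + s *: v)) =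
        inner (G (F (w + s *: v))) ('D_v F (w + s *: v)) ('D_v F (w + s *: v)).
      apply: (etrans (esym (inner_pullback _ _ (@flat R n) y _ v v (dy' s Qs)))).
      by rewrite iso//; exact: inner_pullback (dF' s Qs).
    have E2 := inner_sub_line n (G (F (w + s *: v))) ('D_v F (w + s *: v)) z s (Gs _ Ps).
    have E3 : inner 1%:M (dsigma s *m D') (dsigma s *m D') =
        inner (G (sigma s + a)) (dsigma s) (dsigma s).
      by rewrite inner_mulmx mulmx1 DD'.
    apply: (deficit_nonpos _ _ _ _ _ _ _ _ _ _ _ I1 I2 E1 _ L1).
    apply: (etrans E3).
    apply: (etrans _ (congr1 (fun q => inner (G (sigma s + a) - G (F (w + s *: v)))
      (dsigma s) (dsigma s) + q) E2)).
    by rewrite inner_mxB subrK.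
have tin : - t <= t <= t by rewrite tt lexx.
have tin' : - t <= - t <= t by rewrite tt lexx.
(* The shortcut has the same endpoints as the curve on the hypersurface. *)
have sigE s : s ^+ 2 = t ^+ 2 -> sigma s = F (w + s *: v).
  by move=> st; rewrite /sigma st subrr mul0r scale0r addr0.
have close s : - t <= s <= t -> s ^+ 2 = t ^+ 2 ->
    `|inner 1%:M e (u (sigma s + a)) - inner 1%:M e (y (w + s *: v))| <= eta * t ^+ 3 / 2.
  move=> hs st; have [b1 b2] := inball s hs; have [[Qs _ _] _] := est s (itvP s hs).
  have b3 : ball x0 r (F (w + s *: v)) by apply: le_ball b1; rewrite ge_min lexx orbT.
  have b4 : ball x0 r (sigma s + a) by apply: le_ball b2; rewrite ge_min lexx orbT.
  rewrite -innerBr -(uy _ Qs b3).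
  apply: (le_trans (inner1_le _ _ _)).
  apply: (@le_trans _ _ (M1 * `|a|)); last first.
    rewrite mulrC -ler_pdivlMr//; apply: (le_trans aL).
    by rewrite le_eqVlt; apply/orP; left; apply/eqP; field; rewrite gt_eqF.
  apply: (@le_trans _ _ (n%:R * (`|e| * L) * `|a|)); last by rewrite ler_wpM2r// lerDl.
  rewrite -!mulrA; apply: ler_wpM2l => //; apply: ler_wpM2l => //.
  by apply: (le_trans (uL _ _ b4 b3)); rewrite sigE// addrC addKr.
have := deficit_integral _ _ _ _ _ _ _ _ _ _ _ _ _ t0 kE erefl erefl
  (close t tin erefl) (close (- t) tin' (sqrrN t)) final.
by rewrite /eta divfK.
Qed.

End obstruction_main.

(** * Riemannian distance in a chart *)

Section chart_geometry.
Context {R : realType}.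

(** A larger function has more simple functions below it. *)
Lemma ge0_le_integral_any d (T : measurableType d) (mu : {measure set T -> \bar R})
    (D : set T) (f h : T -> \bar R) :
  (forall x, D x -> 0 <= f x)%E -> (forall x, D x -> f x <= h x)%E ->
  (\int[mu]_(x in D) f x <= \int[mu]_(x in D) h x)%E.
Proof.
move=> f0 fh; rewrite integral_mkcond [leRHS]integral_mkcond.
have h0 x : D x -> (0 <= h x)%E by move=> Dx; exact: le_trans (f0 x Dx) (fh x Dx).
rewrite !ge0_integralTE; [|exact: erestrict_ge0..].
apply: le_ereal_sup => _ [k /= kf <-]; exists k => // x.
by apply: le_trans (kf x) _; exact: lee_restrict.
Qed.

Context {n : nat} {M : manifold R n}.

Lemma overlap_open (c c' : chart R n M) : open (cmap c @` (cdom c `&` cdom c')).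
Proof.
rewrite openE => _ [q [cq c'q] <-]; rewrite /interior.
have iq : (cmap c @` cdom c) (cmap c q) by exists q.
have n1 : \forall x \near cmap c q, (cmap c @` cdom c) x.
  by apply: open_nbhs_nbhs; split => //; exact: cimg_open.
have n2 : \forall x \near cmap c q, cdom c' (cinv c x).
  apply: (cinv_continuous iq); rewrite cmapK//.
  by apply: open_nbhs_nbhs; split => //; exact: cdom_open.
move: n1 n2; apply: filterS2 => _ [q' cq' <-]; rewrite cmapK// => c'q'.
by exists q'.
Qed.

(** The norm of the topology is the maximum of the coordinates. *)
Lemma rV_norm_enorm k (x : 'rV[R]_k) : `|x| <= enorm x.
Proof.
apply: rV_norm_le; first exact: sqrtr_ge0.
move=> i; rewrite -sqrtr_sqr ler_wsqrtr// /inner mulmx1 mxE (bigD1 i)//= mxE -expr2.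
by rewrite lerDl; apply: sumr_ge0 => j _; rewrite mxE -expr2 sqr_ge0.
Qed.

Lemma segment_ball k (x0 x y : 'rV[R]_k) r t :
  ball x0 r x -> ball x0 r y -> 0 <= t <= 1 -> ball x0 r (x + t *: (y - x)).
Proof.
rewrite -!ball_normE/= => xr yr /andP[t0 t1].
have -> : x0 - (x + t *: (y - x)) = (1 - t) *: (x0 - x) + t *: (x0 - y).
  by apply/rowP => i; rewrite !mxE; ring.
apply: (le_lt_trans (ler_normD _ _)); rewrite !normrZ !ger0_norm ?subr_ge0//.
rewrite [X in _ < X](_ : r = (1 - t) * r + t * r); last by ring.
move: t0; rewrite le_eqVlt => /predU1P[<-|t0].
  by rewrite subr0 !mul0r !addr0 !mul1r.
by apply: ler_ltD; [apply: ler_wpM2l; [rewrite subr_ge0|exact: ltW]|rewrite ltr_pM2l].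
Qed.

Lemma chart_atP (x : M) : atlas (chart_at x) /\ cdom (chart_at x) x.
Proof. by rewrite /chart_at; case: cid2. Qed.

Section segment.
Context (c : chart R n M) (x h : 'rV[R]_n).
Let gam (t : R) : M := cinv c (x + t *: h).

Lemma segment_derive (c' : chart R n M) t :
  atlas c -> atlas c' -> (cmap c @` cdom c) (x + t *: h) -> cdom c' (gam t) ->
  \forall s \near t, is_derive s (1 : R) (cmap c' \o gam) ('D_h (cmap c' \o cinv c) (x + s *: h)).
Proof.
move=> ac ac' [q cq qE] c't.
have Qt : (cmap c @` (cdom c `&` cdom c')) (x + t *: h).
  by exists q => //; split => //; move: c't; rewrite /gam -qE cmapK.
have : \forall s \near t, (cmap c @` (cdom c `&` cdom c')) (x + s *: h).
  have cl : {for t, continuous (fun s : R => x + s *: h)}.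
    by apply: cvgD; [exact: cvg_cst|apply: cvgZr_tmp; exact: cvg_id].
  by apply: cl; apply: open_nbhs_nbhs; split => //; exact: overlap_open.
apply: filterS => s Qs; apply: is_derive_line; apply: diff_derivable.
exact: smooth_on_differentiable (atlas_compatible ac ac') Qs.
Qed.

(** Segments of a chart are admissible in the definition of the distance: a
transition map turns their expression in the chart [c] into that in any other. *)
Lemma segment_C1 :
  atlas c -> (forall t, 0 <= t <= 1 -> (cmap c @` cdom c) (x + t *: h)) -> C1_curve gam.
Proof.
move=> ac ht t t01; have cl : {for t, continuous (fun s : R => x + s *: h)}.
  by apply: cvgD; [exact: cvg_cst|apply: cvgZr_tmp; exact: cvg_id].
split.
  exact: (@continuous_comp _ _ _ (fun s : R => x + s *: h) (cinv c) t cl (cinv_continuous (ht t t01))).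
move=> c' ac' c't; have nd := segment_derive c' t ac ac' (ht t t01) c't.
split; first by apply: filterS nd => s [].
have [q cq qE] := ht t t01.
have Qt : (cmap c @` (cdom c `&` cdom c')) (x + t *: h).
  by exists q => //; split => //; move: c't; rewrite /gam -qE cmapK.
have cD : {for t, continuous (fun s : R => 'D_h (cmap c' \o cinv c) (x + s *: h))}.
  apply: (@continuous_comp _ _ _ (fun s : R => x + s *: h)
    (fun p => 'D_h (cmap c' \o cinv c) p) t cl).
  apply: differentiable_continuous.
  exact: (smooth_on_derive _ _ _ _ _ _ (overlap_open c c') (atlas_compatible ac ac') Qt).
have E : {near t, (fun s : R => 'D_h (cmap c' \o cinv c) (x + s *: h)) =1 derive1 (cmap c' \o gam)}.
  by apply: filterS nd => s [_ hs]; rewrite derive1E hs.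
have Et : 'D_h (cmap c' \o cinv c) (x + t *: h) = derive1 (cmap c' \o gam) t := nbhs_singleton E.
have cE := cvg_trans (near_eq_cvg E) cD.
exact: (@eq_ind _ _ (fun l => derive1 (cmap c' \o gam) @ t --> l) (cE _) _ Et).
Qed.

(** The speed is defined through an arbitrary chart at each point; the
transformation rule of the metric brings it back to the chart [c]. *)
Lemma segment_speed (g : riem_metric M) t :
  atlas c -> (cmap c @` cdom c) (x + t *: h) ->
  speed g gam t = Num.sqrt (inner (g c (x + t *: h)) h h).
Proof.
move=> ac [q cq qE]; rewrite /speed.
have [ac' c't] := chart_atP (gam t); set c' := chart_at _ in ac' c't *.
have it : (cmap c @` cdom c) (x + t *: h) by exists q.
have Qt : (cmap c @` (cdom c `&` cdom c')) (x + t *: h).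
  by exists q => //; split => //; move: c't; rewrite /gam -qE cmapK.
have [_ hd] := nbhs_singleton (segment_derive c' t ac ac' it c't).
rewrite derive1E hd; congr Num.sqrt.
have dT := smooth_on_differentiable _ _ _ _ _ (atlas_compatible ac ac') Qt.
by rewrite (gram_transition g ac ac' Qt) inner_pullback.
Qed.

End segment.

(** The distance between two points is at most the length of the segment that joins
them in the chart, so [u] is Lipschitz for the norm of the chart. *)
Lemma chart_lipschitz (g : riem_metric M) (U : set M) (u : M -> 'rV[R]_n)
    (c : chart R n M) (p : M) :
  atlas c -> cdom c p -> nbhs p U -> riem_lipschitz g U u ->
  exists2 r, 0 < r & exists2 L, 0 <= L &
    (forall x, ball (cmap c p) r x -> (cmap c @` cdom c) x /\ U (cinv c x)) /\
    (forall x y, ball (cmap c p) r x -> ball (cmap c p) r y ->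
       `|u (cinv c x) - u (cinv c y)| <= L * `|x - y|).
Proof.
move=> ac cp nU [L0 L00 uL].
have ip : (cmap c @` cdom c) (cmap c p) by exists p.
have n1 : \forall x \near cmap c p, (cmap c @` cdom c) x.
  by apply: open_nbhs_nbhs; split => //; exact: cimg_open.
have n2 : \forall x \near cmap c p, U (cinv c x).
  by apply: (cinv_continuous ip); rewrite cmapK.
have n3 : \forall x \near cmap c p, `|g c x| <= `|g c (cmap c p)| + 1.
  have cg : {for cmap c p, continuous (g c)}.
    have dg : differentiable (g c) (cmap c p).
      exact: (smooth_on_differentiable _ _ _ _ _ (gram_smooth g ac) ip).
    exact: (differentiable_continuous dg).
  have hc := (cvgrPdist_le _ _).1 cg 1 ltr01.
  near=> x; have h : `|g c (cmap c p) - g c x| <= 1 by near: x; exact: hc.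
  rewrite -[g c x](subKr (g c (cmap c p))); apply: (le_trans (ler_normB _ _)); exact: lerD.
have [r r0 rP] := (nbhs_ballP _ _).1 (filterI n1 (filterI n2 n3)).
exists r => //.
pose K := n%:R ^+ 2 * (`|g c (cmap c p)| + 1).
have K0 : 0 <= K by rewrite mulr_ge0 ?exprn_ge0 ?addr_ge0.
exists (L0 * Num.sqrt K); first by rewrite mulr_ge0 ?sqrtr_ge0 ?ltW.
split=> [x /rP[? []]//|x y xr yr].
have [ix [Ux _]] := rP x xr; have [iy [Uy _]] := rP y yr.
apply: (le_trans (rV_norm_enorm _ _)).
rewrite -lee_fin; apply: (le_trans (uL _ _ Ux Uy)).
rewrite -mulrA EFinM; apply: lee_wpmul2l; first by rewrite lee_fin ltW.
pose gam (t : R) : M := cinv c (x + t *: (y - x)).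
have seg t : 0 <= t <= 1 -> ball (cmap c p) r (x + t *: (y - x)) by exact: segment_ball.
apply: (@le_trans _ _ (curve_length g gam)).
  apply: ereal_inf_lbound; exists gam => //; split.
  - by apply: segment_C1 => // t t01; have [] := rP _ (seg t t01).
  - by rewrite /gam scale0r addr0.
  - by rewrite /gam scale1r addrC subrK.
apply: (@le_trans _ _ (\int[@lebesgue_measure R]_(t in `[0%R, 1%R]) (Num.sqrt K * `|x - y|)%:E)%E).
  apply: ge0_le_integral_any => t /=; rewrite in_itv/= => t01.
    by rewrite lee_fin sqrtr_ge0.
  have [it [_ gt]] := rP _ (seg t t01).
  have nE : `|x - y| = Num.sqrt (`|x - y| ^+ 2) by rewrite sqrtr_sqr normr_id.
  rewrite lee_fin segment_speed// [X in _ <= _ * X]nE -sqrtrM//; apply: ler_wsqrtr.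
  apply: (le_trans (ler_norm _)); apply: (le_trans (inner_le _ _ _ _)).
  rewrite /K -[leRHS]mulrA; apply: ler_wpM2l; first exact: exprn_ge0.
  rewrite -expr2 distrC; apply: ler_wpM2r => //; exact: sqr_ge0.
rewrite integral_cst//= lebesgue_measure_itv/= lte_fin ltr01 -EFinD subr0 mule1.
by [].
Unshelve. all: by end_near. Qed.

End chart_geometry.

(** * The exceptional set *)

(** The determinant is positive at the identity and does not vanish on the segment
to [G], which consists of positive definite matrices. *)
Lemma posdef_det_gt0 (R : realType) n (G : 'M[R]_n) : posdef n G -> 0 < \det G.
Proof.
move=> pG; pose phi (t : R) := \det ((1 - t) *: (1%:M : 'M[R]_n) + t *: G).
have cphi : continuous phi.
  move=> t; apply: cvg_det; apply: cvgD; apply: cvgZr_tmp; last exact: cvg_id.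
  by apply: cvgB; [exact: cvg_cst|exact: cvg_id].
have phi_neq0 t : 0 <= t <= 1 -> phi t != 0.
  move=> /andP[t0 t1]; rewrite -unitfE -unitmxE; apply: posdef_unitmx => v v0.
  rewrite inner_mxD !inner_mxZ.
  have h1 := inner1_gt0 n v v0; have h2 := pG v v0.
  move: t0; rewrite le_eqVlt => /predU1P[<-|t0].
    by rewrite subr0 mul1r mul0r addr0.
  by apply: ltr_wpDl; [apply: mulr_ge0; [rewrite subr_ge0|exact: ltW]|exact: mulr_gt0].
have p0 : phi 0 = 1 by rewrite /phi subr0 scale1r scale0r addr0 det1.
have p1 : phi 1 = \det G by rewrite /phi subrr scale0r scale1r add0r.
rewrite -p1 lt_neqAle eq_sym phi_neq0 ?ler01 ?lexx//= leNgt; apply/negP => p1lt.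
have [||t] := @IVT R phi 0 1 0 ler01.
- exact: continuous_subspaceT.
- by rewrite p0 ge_min le_max ler01 (ltW p1lt) orbT.
- rewrite in_itv/= => t01 /eqP; apply/negP; exact: phi_neq0.
Qed.

Lemma class_C_sub (R : realType) k m (V : normedModType R) (A B : set 'rV[R]_m)
    (F : 'rV[R]_m -> V) : A `<=` B -> class_C k B F -> class_C k A F.
Proof.
elim: k F => [|k IHk] F AB /=; first by move=> h x /AB; exact: h.
by move=> [h1 h2]; split => [x /AB|i]; [exact: h1|apply: IHk].
Qed.

(** Near [x0] the density sqrt(det g) is bounded below, so a set that is negligible
for the Riemannian measure is null for the iterated Lebesgue integral. *)
Lemma negligible_curve (R : realType) (n : nat) (M : manifold R n) (g : riem_metric M)
    (c : chart R n M) (N : set M) (x0 : 'rV[R]_n) :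
  atlas c -> (cmap c @` cdom c) x0 -> riem_negligible g N ->
  exists2 r0, 0 < r0 & forall r, 0 < r -> r <= r0 ->
  forall (sigma : R -> 'rV[R]_n) rho, continuous sigma -> 0 < rho ->
    exists2 a : 'rV[R]_n, `|a| < rho & (@lebesgue_measure R).-negligible
      [set t | ball x0 r (sigma t + a) /\ (cmap c @` (N `&` cdom c)) (sigma t + a)].
Proof.
move=> ac ix negN; have [B [mB NB BC IB]] := negN c ac.
have pdet : 0 < \det (g c x0) by apply: posdef_det_gt0 => v; exact: gram_pos.
have dg : differentiable (g c) x0 := smooth_on_differentiable _ _ _ _ _ (gram_smooth g ac) ix.
have cdet := cvg_det _ _ _ _ (g c) _ (differentiable_continuous dg).
pose k := Num.sqrt (\det (g c x0) / 2).
have p20 : 0 < \det (g c x0) / 2 by rewrite divr_gt0.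
have k0 : 0 < k by rewrite sqrtr_gt0.
have nk : \forall x \near x0, \det (g c x0) / 2 < \det (g c x).
  have hc := (cvgrPdist_lt _ _).1 (cdet _) _ p20.
  near=> x; have : `|\det (g c x0) - \det (g c x)| < \det (g c x0) / 2 by near: x; exact: hc.
  by move=> /(le_lt_trans (ler_norm _)); lra.
have [r0 r00 r0P] := (nbhs_ballP _ _).1 nk.
exists r0 => // r rgt0 rr0 sigma rho csigma rho0.
pose B' : set (g_sigma_algebraType (@open 'rV[R]_n)) := B `&` ball x0 r.
have mB' : measurable B'.
  apply: measurableI; first exact: mB.
  by apply: sub_sigma_algebra; exact: ball_open.
have IB' : integral_rV (fun x : 'rV[R]_n => (\1_B' (x : g_sigma_algebraType (@open 'rV[R]_n)) * k)%:E) = 0%E.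
  apply/eqP; rewrite eq_le; apply/andP; split; last first.
    by apply: integral_rV_ge0 => x; rewrite lee_fin mulr_ge0// ltW.
  rewrite -[leRHS]IB; apply: le_integral_rV => x.
    by rewrite lee_fin mulr_ge0// ltW.
  rewrite lee_fin !indicE; have [xB'|xB'] := boolP (x \in B'); last first.
    by rewrite mul0r mulr_ge0// sqrtr_ge0.
  have [Bx bx] : B' x by rewrite inE in xB'.
  rewrite mem_set// !mul1r; apply: ler_wsqrtr; apply: ltW; apply: r0P.
  exact: le_ball bx.
have [a ar na] := null_translate n B' k sigma rho mB' k0 IB' csigma rho0.
exists a => //; apply: negligibleS na => t [bt [q [Nq cq] qE]]; split => //.
by apply: NB; exists q.
Unshelve. all: by end_near. Qed.

(** * The theorem *)

(* c is any chart of M at p, and s : W -> M any local parametrization of S with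
   s w = p; every vector of T_p S is ds_w(v) for a unique v. *)
Theorem proposition2p2 (R : realType) (n : nat) (M : manifold R n)
    (g : riem_metric M) (S : set M) (f : M -> 'rV[R]_n) (p : M) (U : set M)
    (c : chart R n M) (W : set 'rV[R]_n.-1) (s : 'rV[R]_n.-1 -> M)
    (w : 'rV[R]_n.-1) (nu nubar : 'rV[R]_n) :
  (2 <= n)%N ->
  hypersurface S ->
  isometric_immersion g S f ->
  S p ->
  nbhs p U ->
  atlas c -> cdom c p ->
  local_param S W s -> W w -> s w = p ->
  unit_normal (g c) (cmap c \o s) w nu ->
  unit_normal (@flat R n) (f \o s) w nubar ->
  (exists v : 'rV[R]_n.-1,
      inner (pullback (g c) (cmap c \o s) w) v v = 1 /\
      `|scalar_second_ff (g c) (cmap c \o s) w nu v v| >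
      `|scalar_second_ff (@flat R n) (f \o s) w nubar v v|) ->
  ~ exists u : M -> 'rV[R]_n, isometric_lipschitz_extension g S f U u.
Proof.
move=> n2 _ iso _ nU ac cp lp Ww swp unu unub [v [v1 hh]] [u [uL uneg uf]].
have [opW cs _ himg hs] := lp.
have [sfW ffW isoW] := iso W s lp.
have [sF fF] := hs c ac.
pose Q : set 'rV[R]_n.-1 := W `&` s @^-1` cdom c.
have opQ : open Q.
  rewrite openE => x [Wx cx]; rewrite /interior.
  have n1 : \forall y \near x, W y by exact: open_nbhs_nbhs.
  have n2' : \forall y \near x, cdom c (s y).
    apply: (cs x Wx); apply: open_nbhs_nbhs; split => //; exact: cdom_open.
  by apply: filterS2 n1 n2' => y.
have Qw : Q w by split => //; rewrite /= swp.
have sy : smooth_on Q (f \o s).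
  by move=> k; apply: class_C_sub (sfW k) => x [].
pose P : set 'rV[R]_n := cmap c @` cdom c.
have PF : P ((cmap c \o s) w) by exists p => //=; rewrite swp.
have Gs x : P x -> (g c x)^T = g c x by exact: gram_sym.
have pG : posdef n (g c ((cmap c \o s) w)) by move=> z; exact: gram_pos.
have dG : differentiable (g c) ((cmap c \o s) w).
  exact: (smooth_on_differentiable _ _ _ _ _ (gram_smooth g ac) PF).
have isoQ w' : Q w' -> pullback (@flat R n) (f \o s) w' = pullback (g c) (cmap c \o s) w'.
  by move=> [Ww' cw']; exact: isoW.
have lt := acceleration_lt n Q (cmap c \o s) (f \o s) (g c) w v nu nubar (ltnW n2) opQ sF sy Qw
  (fF w Ww Qw.2) (ffW w Ww) dG (Gs _ PF) pG isoQ unu unub hh.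
rewrite nabla_flat in lt.
(* In the chart c, the map u is Lipschitz near c(p), and translates of curves avoid the exceptional set. *)
have [r1 r10 [L L0 [inU uLip]]] := chart_lipschitz g U u c p ac cp nU uL.
have [r2 r20 hneg] := negligible_curve R n M g c _ (cmap c p) ac (ex_intro2 _ _ p cp erefl) uneg.
pose r := Num.min r1 r2.
have r0 : 0 < r by rewrite lt_min r10.
have rr1 : r <= r1 by rewrite ge_min lexx.
have rr2 : r <= r2 by rewrite ge_min lexx orbT.
have Fw : (cmap c \o s) w = cmap c p by rewrite /= swp.
have e1 : inner 1%:M ('D_v (f \o s) w) ('D_v (f \o s) w) = 1.
  have dy := smooth_on_differentiable _ _ _ _ _ sy Qw.
  by apply: (etrans (esym (inner_pullback _ _ (@flat R n) _ _ v v dy))); rewrite isoQ.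
have opP : open P by exact: cimg_open.
suff : inner (g c ((cmap c \o s) w)) (nabla (g c) (cmap c \o s) w v v)
    (nabla (g c) (cmap c \o s) w v v) <=
  inner 1%:M ('D_v (fun x => 'D_v (f \o s) x) w) ('D_v (fun x => 'D_v (f \o s) x) w).
  by rewrite leNgt lt.
apply: (coordinate_obstruction n _ Q (cmap c \o s) (f \o s) P (g c) w v (u \o cinv c) r L
  opQ sF sy Qw opP (gram_smooth g ac) PF Gs (posdef_unitmx _ _ pG) isoQ e1 r0 L0); rewrite Fw.
- by move=> x x' bx bx'; apply: uLip; [exact: le_ball bx|exact: le_ball bx'].
- move=> w' [Ww' cw'] bw'; have [_ ] := inU _ (le_ball rr1 bw').
  rewrite /= cmapK// => Us.
  (* The image of s lies in S. *)
  have [Q' opQ' sWE] := himg W opW (fun _ h => h).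
  have [Ss _] : (S `&` Q') (s w') by rewrite -sWE; exists w'.
  exact: uf.
- move=> sigma rho csigma rho0; have [a ar na] := hneg r r0 rr2 sigma rho csigma rho0.
  exists a => //; apply: negligibleS na => t [bt nd]; split => //.
  have [[q cq qE] Uq] := inU _ (le_ball rr1 bt).
  rewrite -qE cmapK// in Uq.
  exists q => //; split => //; split => // isoq; apply: nd.
  have [D Dd DG] := isoq c ac cq.
  exists D; last by rewrite -qE.
  rewrite -qE => e e0; have nb : \forall x \near cmap c q, ball (cmap c p) r x.
    by apply: open_nbhs_nbhs; split; [exact: ball_open|rewrite qE].
  move: nb (Dd e e0); apply: filterS2 => x bx + _; apply.
  have [[q' cq' qE'] Uq'] := inU _ (le_ball rr1 bx).
  by rewrite -qE' cmapK// in Uq'; exists q'.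
Qed.
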